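(* For any integers $a,b\geq 0$, we have $$t^{\star,V}_{\overline{\ast}}(\{2\}^a,1,\{2\}^b)=\sum_{r=1}^{a+b}2^{-2r}\left[\binom{2r}{2a}+(1-2^{-2r})\binom{2r}{2b}\right]t^\star\bigl(\{2\}^{a+b-r}\bigr)\zeta(2r+1)+\delta_{a=0}(V-\log 2)\,t^\star(\{2\}^b)+\delta_{b=0}\log(2)\,t^\star(\{2\}^a),$$ where $\delta$ is the Kronecker symbol.
   Context: For positive integers $k_1,\ldots,k_n$ with $k_1>1$, $$t(k_1,\ldots,k_n)=\sum_{m_1>\cdots>m_n>0,\ m_i\ \mathrm{odd}}\frac{1}{m_1^{k_1}\cdots m_n^{k_n}},\qquad t^\star(k_1,\ldots,k_n)=\sum_{m_1\geq\cdots\geq m_n>0,\ m_i\ \mathrm{odd}}\frac{1}{m_1^{k_1}\cdots m_n^{k_n}},$$ and $t(\varnothing)=t^\star(\varnothing)=1$. $\{2\}^n$ denotes $2$ repeated $n$ times (empty if $n=0$); $\delta_{a=0}$ is $1$ if $a=0$ and $0$ otherwise. Let $\mathfrak{A}=\mathbb{Q}\langle \mathrm{x},\mathrm{y}\rangle$ be the non-commutative polynomial algebra, $\mathfrak{A}^1=\mathbb{Q}+\mathfrak{A}\mathrm{y}$, $\mathfrak{A}^0=\mathbb{Q}+\mathrm{x}\mathfrak{A}\mathrm{y}$, and $\mathrm{z}_k=\mathrm{x}^{k-1}\mathrm{y}$ for $k\geq1$. The stuffle product $\ast$ on $\mathfrak{A}^1$ is the $\mathbb{Q}$-bilinear commutative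 product given by $1\ast w=w\ast 1=w$ and $\mathrm{z}_kw_1\ast \mathrm{z}_lw_2=\mathrm{z}_k(w_1\ast \mathrm{z}_lw_2)+\mathrm{z}_l(\mathrm{z}_kw_1\ast w_2)+\mathrm{z}_{k+l}(w_1\ast w_2)$. Let $S:\mathfrak{A}^1\to\mathfrak{A}^1$ be the $\mathbb{Q}$-linear map with $S(1)=1$ and $S(w\mathrm{y})=\gamma(w)\mathrm{y}$, where $\gamma$ is the algebra automorphism of $\mathfrak{A}$ with $\gamma(\mathrm{x})=\mathrm{x}$, $\gamma(\mathrm{y})=\mathrm{x}+\mathrm{y}$. The stuffle regularization with parameter $V$ is the unique algebra homomorphism $t^V_\ast:(\mathfrak{A}^1,\ast)\to\mathbb{R}[V]$ with $t^V_\ast(\mathrm{z}_{k_1}\cdots \mathrm{z}_{k_n})=t(k_1,\ldots,k_n)$ whenever $k_1>1$ and $t^V_\ast(\mathrm{z}_1)=V$. The star-stuffle regularization is $t^{\star,V}_{\overline{\ast}}(w)=t^V_\ast(S(w))$ for $w\in\mathfrak{A}^1$, and for an index, $t^{\star,V}_{\overline{\ast}}(k_1,\ldots,k_n)=t^{\star,V}_{\overline{\ast}}(\mathrm{z}_{k_1}\cdots \mathrm{z}_{k_n})$. $\zeta$ is the Riemann zeta function, and $\binom{p}{q}=0$ for integers $q>p\geq0$. *)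

(* Defs.v *)
From HB Require Import structures.
From mathcomp Require Import all_boot all_order all_algebra.
From mathcomp Require Import all_classical all_reals all_analysis.
From mathcomp Require Import -(notations) finmap.
From mathcomp.multinomials Require Import -(notations) monalg.

Set Implicit Arguments.
Unset Strict Implicit.
Unset Printing Implicit Defensive.

Import Order.TTheory GRing.Theory Num.Theory.
Import numFieldNormedType.Exports.

Local Open Scope classical_set_scope.
Local Open Scope ring_scope.

(* Q<x, y>: the monoid algebra over rat of the free monoid on two letters,
   with false standing for x and true for y. *)
Notation word := (fmonom bool).
Notation ncpoly := (malg word rat).

Definition xA : ncpoly := mkmalgU (fmu false) 1.
Definition yA : ncpoly := mkmalgU (fmu true) 1.

Definition A1 : set ncpoly :=
  [set u | exists (c : rat) (w : ncpoly), u = c%:A + w * yA].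

(* Only meaningful for k >= 1. *)
Definition z (k : nat) : ncpoly := xA ^+ k.-1 * yA.

Definition zword (ks : seq nat) : ncpoly := \prod_(k <- ks) z k.

(* The recursion defining the stuffle product, on two words given by
   their indices. *)
Fixpoint stuffle_index (ks : seq nat) : seq nat -> ncpoly :=
  fix stuffle_ks (ls : seq nat) : ncpoly :=
    match ks, ls with
    | [::], _ => zword ls
    | _, [::] => zword ks
    | k :: ks', l :: ls' =>
        z k * stuffle_index ks' ls + z l * stuffle_ks ls'
        + z (k + l)%N * stuffle_index ks' ls'
    end.

(* index_of 0 w is the index (k_1, ..., k_n) such that w = z_{k_1} ... z_{k_n},
   when w is empty or ends with y (trailing letters x are dropped otherwise);
   the accumulator j counts the letters x read since the last y. *)
Fixpoint index_of (j : nat) (w : seq bool) : seq nat :=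
  match w with
  | [::] => [::]
  | false :: w' => index_of j.+1 w'
  | true :: w' => j.+1 :: index_of 0 w'
  end.

(* Bilinear extension to all of Q<x, y>; only its values on A1 matter. *)
Definition stuffle (u v : ncpoly) : ncpoly :=
  \sum_(w1 <- msupp u) \sum_(w2 <- msupp v)
    (mcoeff w1 u * mcoeff w2 v) *: stuffle_index (index_of 0 w1) (index_of 0 w2).

(* The algebra morphism x |-> x, y |-> x + y, as the linear extension of its
   values on words. *)
Definition gamma (u : ncpoly) : ncpoly :=
  \sum_(w <- msupp u)
    mcoeff w u *: \prod_(l <- fmonom_val w) (if l then xA + yA else xA).

(* S on a single word; words ending with x are outside A1 and are sent to 0. *)
Definition S_word (w : word) : ncpoly :=
  if fmonom_val w == [::] then 1
  else if last false w then gamma (mkmalgU (FMonom (take (size w).-1 w)) 1) * yA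
  else 0.

Definition S_map (u : ncpoly) : ncpoly :=
  \sum_(w <- msupp u) mcoeff w u *: S_word w.

Section Values.
Variable R : realType.

(* Sum of 1 / (m_1 ^ k_1 ... m_n ^ k_n) over the odd (hence positive) m_i such
   that e m_i m_(i+1) for all i, with e transitive.  The terms are nonnegative,
   so the unordered sum is the iterated one; it is 1 on the empty index. *)
Definition odd_sum (e : rel nat) (ks : seq nat) : R :=
  fine (\esum_(m in [set m : seq nat |
                     [/\ size m = size ks, sorted e m & all odd m]])
         (\prod_(p <- zip m ks) p.1%:R ^- p.2)%:E)%E.

Definition mtv : seq nat -> R := odd_sum gtn.
Definition mtv_star : seq nat -> R := odd_sum geq.

Definition zeta (s : R) : R := limn (series (riemannR s)).

(* The algebra homomorphisms (A1, stuffle) -> R[V] extending t with z_1 |-> V;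
   V is the indeterminate of {poly R}.  The values of phi outside A1 are
   irrelevant. *)
Record stuffle_regularization (phi : ncpoly -> {poly R}) : Prop := {
  reg_linear : forall (c : rat) (u v : ncpoly), A1 u -> A1 v ->
    phi (c *: u + v) = (ratr c : R) *: phi u + phi v ;
  reg_one : phi 1 = 1 ;
  reg_stuffle : forall u v : ncpoly, A1 u -> A1 v ->
    phi (stuffle u v) = phi u * phi v ;
  reg_mtv : forall (k : nat) (ks : seq nat),
    (1 < k)%N -> all (fun i => 0 < i)%N ks ->
    phi (zword (k :: ks)) = (mtv (k :: ks))%:P ;
  reg_z1 : phi (z 1%N) = 'X
}.

Definition mtv_star_reg (phi : ncpoly -> {poly R}) (ks : seq nat) : {poly R} :=
  phi (S_map (zword ks)).

End Values.

(* Main.v *)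
Require Import Defs.
From mathcomp Require Import all_boot all_order all_algebra.
From mathcomp Require Import all_classical all_reals all_analysis.
From mathcomp Require Import -(notations) finmap.
From mathcomp.multinomials Require Import -(notations) monalg.
From mathcomp Require Import ring lra zify.

Set Implicit Arguments.
Unset Strict Implicit.
Unset Printing Implicit Defensive.

Import Order.TTheory GRing.Theory Num.Theory.
Import numFieldNormedType.Exports.

Local Open Scope classical_set_scope.
Local Open Scope ring_scope.

(* Write P_N(b) and U_N(a,b) for the star sums of ({2}^b) and ({2}^a,1,{2}^b)
   truncated to m_i <= 2N+1.  Partial fractions of prod_m (1 - x^2/m^2)^-1 give
   weights w_(N,J) with
     P_N(b)   = sum_(J <= N) w_(N,J) (-1)^J / (2J+1)^(2b+1),
     U_N(a,b) = sum_(I <= N) w_(N,I) s_b(I) / (2I+1)^(2a+1),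
   where s_b(I) sums (-1)^J / (2J+1)^(2b+1) over J <= I, doubled for J < I; both
   are proved by induction on the recursions of the truncated sums.  The weights
   converge, boundedly, to a constant L, which need not be identified with 4/pi:
   L beta(2b+1) = t*({2}^b), in particular L beta(1) = 1.  For a = 0, U_N(0,b)
   diverges like (sum_(J <= N) 1/(2J+1)) P_N(b), and the stuffle relation with
   z_1 shows that V replaces the divergent sum; since U_N(0,0) is exactly that
   sum, only a convergent combination of U_N(0,b) and U_N(0,0) is left.

   The double sum with w replaced by 1 runs, after symmetrization, over odd i, j
   in a square with i + j = k > 0.  Expanding 1/(i^(2a+1) j^(2b+1)) in partial
   fractions with respect to k separates it into products of a beta value and an
   (alternating) zeta value over the even integers k. *)

(** * Words and the stuffle product by z_1 *)

Local Notation U w := (mkmalgU (FMonom (w : seq bool)) (1 : rat)).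

Definition zletters (k : nat) : seq bool := rcons (nseq k.-1 false) true.

Definition zletters_of (ks : seq nat) : seq bool :=
  flatten [seq zletters k | k <- ks].

Lemma zletters_of_cons k ks : zletters_of (k :: ks) = zletters k ++ zletters_of ks.
Proof. by []. Qed.

Lemma mulU (s t : seq bool) : U s * U t = U (s ++ t).
Proof.
rewrite malgM_def fgmulUU mulr1; congr (mkmalgU _ 1).
by apply/eqP; rewrite fmP fmM.
Qed.

Lemma oneU : 1 = U [::].
Proof. by congr (mkmalgU _ 1); apply/eqP; rewrite fmP fm1. Qed.

Lemma xAE : xA = U [:: false].
Proof. by rewrite /xA fmuE. Qed.

Lemma yAE : yA = U [:: true].
Proof. by rewrite /yA fmuE. Qed.

Lemma xAX n : xA ^+ n = U (nseq n false).
Proof. by elim: n => [|n IH]; rewrite ?expr0 ?oneU // exprS IH xAE mulU. Qed.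

Lemma zE k : z k = U (zletters k).
Proof. by rewrite /z xAX yAE mulU cats1. Qed.

Lemma zwordE ks : zword ks = U (zletters_of ks).
Proof.
rewrite /zword; elim: ks => [|k ks IH]; first by rewrite big_nil oneU.
by rewrite big_cons IH zE mulU.
Qed.

Lemma zword_cons k ks : zword (k :: ks) = z k * zword ks.
Proof. by rewrite /zword big_cons. Qed.

Lemma zletters_of_rcons ks : ks != [::] ->
  exists s, zletters_of ks = rcons s true.
Proof.
elim/last_ind: ks => // ks k _ _.
rewrite /zletters_of map_rcons flatten_rcons /zletters -rcons_cat.
by eexists.
Qed.

Lemma A1_zword ks : A1 (zword ks).
Proof.
have [->|/zletters_of_rcons[s e]] := eqVneq ks [::].
  by exists 1, 0; rewrite scale1r mul0r addr0 /zword big_nil.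
exists 0, (U s); rewrite scale0r add0r yAE mulU cats1 -e; exact: zwordE.
Qed.

Lemma A1_0 : A1 0.
Proof. by exists 0, 0; rewrite scale0r mul0r addr0. Qed.

Lemma A1D u v : A1 u -> A1 v -> A1 (u + v).
Proof.
move=> [c [w ->]] [d [w' ->]]; exists (c + d), (w + w').
by rewrite scalerDl mulrDl addrACA.
Qed.

Lemma A1_sum_zword (s : seq (seq nat)) : A1 (\sum_(l <- s) zword l).
Proof.
apply: (big_ind (fun u => A1 u)) => [|u v|l _]; first exact: A1_0.
- exact: A1D.
- exact: A1_zword.
Qed.

Lemma sum_msuppU (V : lmodType rat) (F : word -> V) (s : seq bool) :
  \sum_(w <- msupp (U s)) mcoeff w (U s) *: F w = F (FMonom s).
Proof. by rewrite msuppU1 big_seq_fset1 mcoeffU1 eqxx scale1r. Qed.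

Lemma index_of_zletters j k s : (0 < k)%N ->
  index_of j (zletters k ++ s) = (j + k)%N :: index_of 0 s.
Proof.
case: k => // k _; rewrite /zletters /=.
elim: k j => [|k IH] j /=; first by rewrite addn1.
by rewrite IH addSnnS.
Qed.

Lemma index_of_zletters_of ks : all (leq 1) ks -> index_of 0 (zletters_of ks) = ks.
Proof.
elim: ks => //= k ks IH /andP[k0 /IH {}IH].
by rewrite [zletters_of _]/= index_of_zletters // [index_of _ _]IH.
Qed.

Lemma stuffle_zword ks ls : all (leq 1) ks -> all (leq 1) ls ->
  stuffle (zword ks) (zword ls) = stuffle_index ks ls.
Proof.
move=> hk hl; rewrite /stuffle !zwordE !msuppU1 !big_seq_fset1 !mcoeffU1 !eqxx.
by rewrite mulr1 scale1r /= !index_of_zletters_of.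
Qed.

(** A list with multiplicities, so that the same list expands the product by [z 1] and the product
    of truncated sums. When [ks] starts with an entry above 1, only the first member of the list
    starts with 1. *)
Fixpoint stuffle1 (ks : seq nat) : seq (seq nat) :=
  if ks is k :: ks' then
    (1%N :: ks) :: (k.+1 :: ks') :: [seq k :: l | l <- stuffle1 ks']
  else [:: [:: 1%N]].

Lemma stuffle_index_nill ls : stuffle_index [::] ls = zword ls.
Proof. by case: ls. Qed.

Lemma stuffle_index_cons k ks l ls :
  stuffle_index (k :: ks) (l :: ls) =
  z k * stuffle_index ks (l :: ls) + z l * stuffle_index (k :: ks) ls
  + z (k + l)%N * stuffle_index ks ls.
Proof. by []. Qed.

Lemma stuffle_index1 ks :
  stuffle_index [:: 1%N] ks = \sum_(l <- stuffle1 ks) zword l.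
Proof.
elim: ks => [|k ks IH]; first by rewrite big_seq1.
rewrite stuffle_index_cons !stuffle_index_nill IH /= !big_cons big_map.
rewrite (zword_cons 1) (zword_cons k.+1) add1n.
rewrite [X in _ = _ + X]addrC addrA; congr (_ + _ + _).
by rewrite mulr_sumr; apply: eq_bigr => l _; rewrite (zword_cons k).
Qed.

(** The indices obtained by turning each comma into a comma or a plus sign, which is the effect of
    [S_map]. A single entry has no comma, hence its separate case. *)
Fixpoint merges (ks : seq nat) : seq (seq nat) :=
  match ks with
  | [::] => [:: [::]]
  | [:: k] => [:: [:: k]]
  | k :: ks' => [seq k :: l | l <- merges ks']
             ++ [seq (k + head 0 l)%N :: behead l | l <- merges ks']
  end.

Lemma merges_cons k ks : ks != [::] -> merges (k :: ks) =
  [seq k :: l | l <- merges ks]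
             ++ [seq (k + head 0 l)%N :: behead l | l <- merges ks].
Proof. by case: ks. Qed.

Lemma merges_neq0 ks l : ks != [::] -> l \in merges ks -> l != [::].
Proof.
case: ks => // k [|k' ks] _; first by rewrite inE => /eqP ->.
by rewrite merges_cons // mem_cat => /orP[] /mapP[l' _ ->].
Qed.

Lemma merges_gt0 ks l : all (leq 1) ks -> l \in merges ks ->
  all (leq 1) l.
Proof.
elim: ks l => [|k [|k' ks] IH] l; first by rewrite inE => _ /eqP ->.
  by rewrite inE => k0 /eqP ->.
rewrite [all _ _]/= merges_cons // mem_cat => /andP[k0 /IH {}IH].
case/orP=> /mapP[l' /IH l'0 ->] /=; first by rewrite k0.
by rewrite ltn_addr //=; case: (l') l'0 => //= ? ? /andP[].
Qed.

Lemma head_merges ks l : l \in merges ks -> (head 0 ks <= head 0 l)%N.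
Proof.
case: ks => [|k [|k' ks]] //=; first by rewrite inE => /eqP ->.
by rewrite mem_cat => /orP[] /mapP[l' _ ->] //=; rewrite leq_addr.
Qed.

Lemma xX_zword k l : l != [::] -> (0 < head 0 l)%N ->
  xA ^+ k * zword l = zword ((k + head 0 l)%N :: behead l).
Proof.
case: l => //= j l _ j0; rewrite !zword_cons mulrA /z mulrA -exprD.
by have -> : ((k + j).-1 = k + j.-1)%N by lia.
Qed.

Lemma gammaU (s : seq bool) :
  gamma (U s) = \prod_(l <- s) (if l then xA + yA else xA).
Proof.
by rewrite /gamma (sum_msuppU
  (fun w => \prod_(l <- fmonom_val w) (if l then xA + yA else xA))).
Qed.

Lemma S_word_zletters ks : ks != [::] ->
  S_word (FMonom (zletters_of ks)) =
  (\prod_(l <- take (size (zletters_of ks)).-1 (zletters_of ks))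
     (if l then xA + yA else xA)) * yA.
Proof.
move=> /zletters_of_rcons[s e]; rewrite -gammaU /S_word [fmonom_val _]/= e.
by rewrite last_rcons; case: s {e}.
Qed.

Lemma prod_nseq_false n :
  \prod_(l <- nseq n false) (if l then xA + yA else xA) = xA ^+ n.
Proof. by elim: n => [|n IH]; rewrite ?big_nil // big_cons IH exprS. Qed.

(** Every y except the last becomes x + y. Its y part keeps the comma, while its x part lengthens
    the next entry ([xX_zword]) and so acts as a plus sign. *)
Lemma gamma_zletters ks : ks != [::] -> all (leq 1) ks ->
  (\prod_(l <- take (size (zletters_of ks)).-1 (zletters_of ks))
     (if l then xA + yA else xA)) * yA = \sum_(l <- merges ks) zword l.
Proof.
elim: ks => // k ks IH _ /andP[k0 ksp].
have [->|ks0] := eqVneq ks [::].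
  rewrite big_seq1 /zletters_of /= cats0 /zletters size_rcons.
  rewrite -cats1 take_size_cat // prod_nseq_false.
  by rewrite zword_cons /zword big_nil mulr1.
(* Only the final y of the whole word escapes [gamma], so the y closing z_k is among the transformed
   letters. *)
have -> : take (size (zletters_of (k :: ks))).-1 (zletters_of (k :: ks)) =
   nseq k.-1 false ++ true :: take (size (zletters_of ks)).-1 (zletters_of ks).
  have [s e] := zletters_of_rcons ks0.
  rewrite zletters_of_cons e /zletters.
  have take_rcons t : take (size (rcons t true)).-1 (rcons t true) = t.
    by rewrite size_rcons -cats1 take_size_cat.
  by rewrite cat_rcons -rcons_cons -rcons_cat !take_rcons.
rewrite big_cat big_cons prod_nseq_false.
rewrite -!mulrA IH // merges_cons // big_cat !big_map /= mulrDl mulrDr addrC.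
congr (_ + _); rewrite mulrA; last first.
  by rewrite mulr_sumr; apply: eq_bigr => l _; rewrite (zword_cons k).
rewrite -exprSr prednK // mulr_sumr.
rewrite big_seq_cond [RHS]big_seq_cond; apply: eq_bigr => l.
rewrite andbT => lm; rewrite xX_zword //.
  exact: merges_neq0 lm.
have := merges_gt0 ksp lm; have := merges_neq0 ks0 lm.
by case: (l) => //= ? ? _ /andP[].
Qed.

Lemma S_map_zword ks : all (leq 1) ks ->
  S_map (zword ks) = \sum_(l <- merges ks) zword l.
Proof.
move=> ksp; rewrite zwordE /S_map sum_msuppU.
have [->|ks0] := eqVneq ks [::]; last by rewrite S_word_zletters // gamma_zletters.
by rewrite /S_word /= big_seq1 /zword big_nil.
Qed.

Lemma stuffle1_gt0 ks l : all (leq 1) ks -> l \in stuffle1 ks -> all (leq 1) l.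
Proof.
elim: ks l => [|k ks IH] l /=; first by rewrite inE => _ /eqP ->.
move=> /andP[k0 ksp]; rewrite !inE => /or3P[/eqP->|/eqP->|/mapP[l' l'm ->]] /=.
- by rewrite k0.
- by [].
- by rewrite k0 IH.
Qed.

(** * The regularization on the expansions of [S_map] and of the product by z_1 *)

Section Regularization.
Variables (R : realType) (phi : ncpoly -> {poly R}).
Hypothesis hphi : stuffle_regularization phi.

Lemma phi_sum (s : seq (seq nat)) :
  phi (\sum_(l <- s) zword l) = \sum_(l <- s) phi (zword l).
Proof.
have phi0 : phi 0 = 0.
  have := reg_linear hphi 1 A1_0 A1_0.
  by rewrite scale1r addr0 rmorph1 scale1r => /(congr1 (fun u => u - phi 0));
     rewrite addrK subrr => ->.
elim: s => [|l s IH]; first by rewrite !big_nil.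
rewrite !big_cons -IH -[zword l]scale1r.
rewrite (reg_linear hphi) ?rmorph1 ?scale1r //; first exact: A1_zword.
exact: A1_sum_zword.
Qed.

Lemma phi_S ks : all (leq 1) ks ->
  phi (S_map (zword ks)) = \sum_(l <- merges ks) phi (zword l).
Proof. by move=> ksp; rewrite S_map_zword // phi_sum. Qed.

Lemma phi_z1M ks : all (leq 1) ks ->
  'X * phi (zword ks) = \sum_(l <- stuffle1 ks) phi (zword l).
Proof.
move=> ksp; rewrite -(reg_z1 hphi) -phi_sum -stuffle_index1.
rewrite -(@stuffle_zword [:: 1%N]) //.
have e : zword [:: 1%N] = z 1%N by rewrite /zword big_seq1.
by rewrite (reg_stuffle hphi) ?e // -?e; exact: A1_zword.
Qed.

End Regularization.

(** * Truncated sums *)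

Section TruncatedSums.
Variable R : realType.
Implicit Types (d N : nat) (ks : seq nat).

(* Entries are 2m+1 with m < N; d = 0 makes them strictly decreasing (the
   truncation of mtv), d = 1 weakly decreasing (that of mtv_star). *)
Fixpoint tsum d N ks : R :=
  if ks is k :: ks' then
    \sum_(m < N) (m.*2.+1)%:R ^- k * tsum d (m + d) ks'
  else 1.

Lemma tsum_cons0 d k ks : tsum d 0 (k :: ks) = 0.
Proof. by rewrite /= big_ord0. Qed.

Lemma tsum_consS d N k ks : tsum d N.+1 (k :: ks) =
  tsum d N (k :: ks) + (N.*2.+1)%:R ^- k * tsum d (N + d) ks.
Proof. by rewrite /= big_ord_recr. Qed.

Lemma tsum_ge0 d N ks : 0 <= tsum d N ks.
Proof.
elim: ks N => [|k ks IH] N //=; apply: sumr_ge0 => m _.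
by rewrite mulr_ge0 // invr_ge0 exprn_ge0.
Qed.

Lemma tsum_leS d N ks : tsum d N ks <= tsum d N.+1 ks.
Proof.
case: ks => [|k ks] //; rewrite tsum_consS lerDl.
by rewrite mulr_ge0 ?tsum_ge0 // invr_ge0 exprn_ge0.
Qed.

Lemma tsum_nondecreasing d ks : nondecreasing_seq (tsum d ^~ ks).
Proof. by apply/nondecreasing_seqP => n; exact: tsum_leS. Qed.

(** Finite counterpart of [S_map_zword]: each weak inequality is either strict or an equality, and
    an equality adds the two exponents. *)
Lemma tsum_merges N ks : tsum 1 N ks = \sum_(l <- merges ks) tsum 0 N l.
Proof.
elim: ks N => [|k ks IH] N; first by rewrite big_seq1.
have [->|ks0] := eqVneq ks [::]; first by rewrite big_seq1.
rewrite merges_cons // big_cat !big_map /=.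
rewrite -big_split /=; under [RHS]eq_bigr do rewrite -big_split /=.
rewrite [RHS]exchange_big; apply: eq_bigr => m _.
rewrite addn1 IH addn0 /= mulr_sumr.
rewrite big_seq [RHS]big_seq; apply: eq_bigr => l lm.
have := merges_neq0 ks0 lm; case: l {lm} => // j l _.
rewrite tsum_consS mulrDr addn0 /=; congr (_ + _).
by rewrite mulrA -invfM -exprD addnC.
Qed.

Lemma tsum_stuffle1 N ks :
  tsum 0 N [:: 1%N] * tsum 0 N ks = \sum_(l <- stuffle1 ks) tsum 0 N l.
Proof.
elim: ks N => [|k ks IH]; first by move=> N; rewrite big_seq1 mulr1.
elim=> [|N IHN].
  rewrite tsum_cons0 mul0r !big_cons big_map !tsum_cons0 !add0r big1 // => l _.
  by rewrite tsum_cons0.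
move: IHN; rewrite !big_cons !big_map => IHN.
have sumS s : \sum_(l <- s) tsum 0 N.+1 (k :: l) =
    \sum_(l <- s) tsum 0 N (k :: l) + (N.*2.+1)%:R ^- k * \sum_(l <- s) tsum 0 N l.
  by rewrite mulr_sumr -big_split; apply: eq_bigr => l _; rewrite tsum_consS addn0.
rewrite sumS !tsum_consS !addn0 -IH mulrDl !mulrDr IHN expr1 exprS invfM mulr1.
ring.
Qed.

Fixpoint odd_seqs d N n : seq (seq nat) :=
  if n is n'.+1 then
    [seq m.*2.+1 :: s | m <- iota 0 N, s <- odd_seqs d (m + d) n']
  else [:: [::]].

Lemma tsumE d N ks : tsum d N ks =
  \sum_(m <- odd_seqs d N (size ks)) \prod_(p <- zip m ks) p.1%:R ^- p.2.
Proof.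
elim: ks N => [|k ks IH] N; first by rewrite /= big_seq1 big_nil.
rewrite [RHS]big_allpairs_dep /= -(big_mkord xpredT
   (fun m => (m.*2.+1)%:R ^- k * tsum d (m + d) ks)) /index_iota subn0.
apply: eq_bigr => m _; rewrite IH mulr_sumr.
by apply: eq_bigr => s _; rewrite big_cons.
Qed.

Lemma odd_seqs_uniq d N n : uniq (odd_seqs d N n).
Proof.
elim: n N => //= n IH N; apply: allpairs_uniq_dep => [|m _|].
- exact: iota_uniq.
- exact: IH.
- by move=> [x s] [y t] _ _ /= [/double_inj-> ->].
Qed.

(** * Truncated sums as partial sums of [odd_sum], for both orders at once *)

Section Order.
Variables (e : rel nat) (d : nat).
Hypothesis ed : forall x y, e x.*2.+1 y.*2.+1 = (y < x + d)%N.

Lemma path_odd_seqs m n s : (s \in odd_seqs d (m + d) n) =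
  [&& size s == n, path e m.*2.+1 s & all odd s].
Proof.
elim: n m s => [|n IH] m s /=; first by rewrite inE; case: s.
apply/allpairsPdep/and3P => [[x [t [xm tx ->]]]|[]].
  move: tx; rewrite IH => /and3P[sz pt ot].
  by split=> //=; rewrite ?eqSS ?ed ?odd_double ?pt //; move: xm; rewrite mem_iota andbT; lia.
case: s => //= x s; rewrite eqSS => sz /andP[mx ps] /andP[ox os].
have xE : x = (x./2).*2.+1 by rewrite -[LHS]odd_double_half ox.
exists x./2, s; split; last by rewrite -xE.
  by rewrite mem_iota /= -ed -xE.
by rewrite IH sz os -xE ps.
Qed.

Lemma mem_odd_seqs N n s : (s \in odd_seqs d N n) =
  [&& size s == n, sorted e s, all odd s & (s == [::]) || (head 0 s < N.*2)%N].
Proof.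
case: n => [|n]; first by rewrite inE; case: s.
apply/allpairsPdep/and4P => [[x [t [xm tx ->]]]|[]].
  move: tx; rewrite path_odd_seqs => /and3P[sz pt ot].
  by split=> //=; rewrite ?odd_double //; move: xm; rewrite mem_iota; lia.
case: s => //= x s; rewrite eqSS => sz ps /andP[ox os] xN.
have xE : x = (x./2).*2.+1 by rewrite -[LHS]odd_double_half ox.
exists x./2, s; split; last by rewrite -xE.
  by rewrite mem_iota /=; lia.
by rewrite path_odd_seqs sz os -xE ps.
Qed.

(** The unordered sum is a supremum over finite sets of sequences. Each such set lies in one of the
    truncations, which increase with N, so the supremum is their limit. *)
Lemma odd_sum_cvg ks (l : R) : tsum d ^~ ks @ \oo --> l -> odd_sum R e ks = l.
Proof.
move=> tl; rewrite /odd_sum.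
set S := [set m | _]; set a := fun m : seq nat => (\prod_(p <- zip m ks) _)%:E.
suff -> : \esum_(m in S) a m = l%:E by [].
have a0 m : (0 <= a m)%E.
  by rewrite lee_fin prodr_ge0 // => p _; rewrite invr_ge0 exprn_ge0.
have SE m : S m <-> exists N, m \in odd_seqs d N (size ks).
  split=> [[sz so od]|[N]].
    by exists (head 0 m).+1; rewrite mem_odd_seqs sz so od eqxx orbC -addnn ltn_addr.
  by rewrite mem_odd_seqs => /and4P[/eqP].
have fE N : finite_set [set` odd_seqs d N (size ks)].
  by apply/finite_seqP; exists (odd_seqs d N (size ks)).
have sumE N : (\sum_(m \in [set` odd_seqs d N (size ks)]) a m)%E = (tsum d N ks)%:E.
  by rewrite -fsbig_seq ?odd_seqs_uniq // tsumE sumEFin.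
apply/eqP; rewrite eq_le; apply/andP; split.
  apply: ge_ereal_sup => _ [A [fA AS] <-].
  have [N AN] : exists N, A `<=` [set` odd_seqs d N (size ks)].
    have [X AX] := finite_fsetP.1 fA.
    (* Membership in a truncation only constrains the head, and the sum of all heads dominates each
       of them. *)
    exists (\sum_(s <- X) (head 0 s)).+1 => s As.
    have [N] := (SE s).1 (AS _ As); rewrite /= !mem_odd_seqs.
    move=> /and4P[-> -> -> _] /=.
    have sX : s \in X by move: As; rewrite AX.
    rewrite (big_rem s) //=; lia.
  apply: (@le_trans _ _ (tsum d N ks)%:E); last first.
    rewrite lee_fin -(cvg_lim _ tl) //; apply: nondecreasing_cvgn_le.
      exact: tsum_nondecreasing.
    by apply/cvg_ex; exists l.
  rewrite -sumE; apply: lee_fsum_nneg_subset => //.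
  by move=> m /set_mem /AN mN; apply: mem_set.
have tle N : ((tsum d N ks)%:E <= \esum_(m in S) a m)%E.
  rewrite -sumE; apply: ereal_sup_ubound; exists [set` odd_seqs d N (size ks)] => //.
  by split => [|m /= mN]; [exact: fE|apply/SE; exists N].
move: tle; case: (\esum_(m in S) a m) => [r| |] tle; rewrite ?leey //.
- rewrite lee_fin -(cvg_lim _ tl) //; apply: limr_le.
    by apply/cvg_ex; exists l.
  by apply: nearW => N; rewrite -lee_fin.
- by have := tle 0%N.
Qed.

End Order.

Lemma mtv_cvg ks (l : R) : tsum 0 ^~ ks @ \oo --> l -> mtv R ks = l.
Proof. by apply: odd_sum_cvg => x y /=; lia. Qed.

Lemma mtv_star_cvg ks (l : R) : tsum 1 ^~ ks @ \oo --> l -> mtv_star R ks = l.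
Proof. by apply: odd_sum_cvg => x y /=; lia. Qed.

End TruncatedSums.

(** * Convergence of the truncated sums for a first entry above 1 *)

Section Boundedness.
Variable R : realType.

Lemma inv_odd_le_inv m : (m.*2.+1)%:R^-1 <= (m.+1)%:R^-1 :> R.
Proof. by rewrite lef_pV2 ?posrE ?ltr0n // ler_nat; lia. Qed.

Lemma inv_oddX_le_invS k m : (0 < k)%N -> (m.*2.+1)%:R ^- k <= (m.+1)%:R^-1 :> R.
Proof.
move=> k0; apply: le_trans (inv_odd_le_inv m).
rewrite -exprVn -[leRHS]expr1; apply: ler_wiXn2l => //.
by rewrite invf_le1 // ler1n.
Qed.

Lemma sqrtr_nat_sqr n : Num.sqrt n%:R ^+ 2 = n%:R :> R.
Proof. by rewrite sqr_sqrtr. Qed.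

Lemma sqrtr_nat_gt0 n : 0 < Num.sqrt n.+1%:R :> R.
Proof. by rewrite sqrtr_gt0. Qed.

(* Each entry of ks costs at most a factor of order log N; the square root
   absorbs all of them and stays summable against 1/m^2. *)
Lemma tsum_le_sqrt ks : all (leq 1) ks ->
  exists2 C : R, 0 <= C & forall N, tsum R 0 N ks <= C * Num.sqrt N.+1%:R.
Proof.
elim: ks => [_|k ks IH /= /andP[k0 /IH [C C0 le_C]]].
  exists 1 => // N; rewrite mul1r -[leLHS]sqrtr1 ler_sqrt ?ler1n //.
exists (2 * C) => [|N]; first by rewrite mulr_ge0.
rewrite -/(tsum R 0 N (k :: ks)).
(* With N under the root the induction starts from an empty sum. Its step is 1/y <= 2 (y - x) for
   consecutive roots x and y, which is (y - x)^2 >= 0 because y^2 - x^2 = 1. *)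
suff: tsum R 0 N (k :: ks) <= 2 * C * Num.sqrt N%:R.
  by move/le_trans; apply; rewrite ler_wpM2l ?mulr_ge0 // ler_wsqrtr // ler_nat.
elim: N => [|N IHN]; first by rewrite tsum_cons0 sqrtr0 mulr0.
rewrite tsum_consS addn0.
have qy := inv_oddX_le_invS N k0; have uy := le_C N.
have u0 := tsum_ge0 R 0 N ks.
have q0 : 0 <= (N.*2.+1)%:R ^- k :> R by rewrite invr_ge0 exprn_ge0.
have y0 := sqrtr_nat_gt0 N; have x0 := sqrtr_ge0 (N%:R : R).
have y2 := sqrtr_nat_sqr N.+1.
have yx : Num.sqrt N.+1%:R ^+ 2 = Num.sqrt N%:R ^+ 2 + 1 :> R.
  by rewrite !sqrtr_nat_sqr natr1.
move: IHN qy uy u0 q0 y0 x0 y2 yx.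
set t := tsum R 0 N (k :: ks); set u := tsum R 0 N ks.
set x := Num.sqrt N%:R; set y := Num.sqrt N.+1%:R; set q := _ ^- k.
move=> IHN + uy u0 q0 y0 x0 y2 yx; rewrite -y2 => qy.
apply: (@le_trans _ _ (2 * C * x + C * y^-1)).
  apply: lerD => //; apply: (@le_trans _ _ (y^-2 * (C * y))).
    by apply: ler_pM.
  by rewrite le_eqVlt; apply/orP; left; apply/eqP; field; exact: lt0r_neq0.
rewrite -subr_ge0.
have -> : 2 * C * y - (2 * C * x + C * y^-1) = C * (2 * y ^+ 2 - 2 * x * y - 1) / y.
  by field; exact: lt0r_neq0.
rewrite divr_ge0 ?(ltW y0) // mulr_ge0 //; have := sqr_ge0 (y - x); nra.
Qed.

(** By [tsum_le_sqrt] the N-th term is of order N^(-3/2), hence summable. *)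
Lemma tsum_le_admissible k ks : (1 < k)%N -> all (leq 1) ks ->
  exists C : R, forall N, tsum R 0 N (k :: ks) <= C.
Proof.
move=> k1 /tsum_le_sqrt[C C0 le_C]; exists (4 * C) => N.
(* A telescoping majorant. For consecutive roots y and z, 1/y - 1/z = 1/(y z (y + z)) >= 1/(2 y z^2)
   >= 1/(4 y^3), since z^2 = y^2 + 1 <= 2 y^2; this fixes the 4. *)
suff: tsum R 0 N (k :: ks) <= 4 * C * (1 - (Num.sqrt N.+1%:R)^-1).
  move/le_trans; apply; rewrite ler_piMr ?mulr_ge0 // gerBl invr_ge0 sqrtr_ge0 //.
elim: N => [|N IHN]; first by rewrite tsum_cons0 sqrtr1 invr1 subrr mulr0.
rewrite tsum_consS addn0.
have q0 : 0 <= (N.*2.+1)%:R ^- k :> R by rewrite invr_ge0 exprn_ge0.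
have uy := le_C N; have u0 := tsum_ge0 R 0 N ks.
have qy : (N.*2.+1)%:R ^- k <= (Num.sqrt N.+1%:R) ^- 4 :> R.
  rewrite -[4%N]/(2 * 2)%N exprM sqrtr_nat_sqr -(subnKC k1) exprD invfM.
  rewrite -[leRHS]mulr1 ler_pM ?invr_ge0 ?exprn_ge0 //.
    by rewrite lef_pV2 ?posrE ?exprn_gt0 ?ltr0n // lerXn2r ?nnegrE // ler_nat; lia.
  by rewrite invf_le1 ?exprn_gt0 ?ltr0n // exprn_ege1 // ler1n.
have y0 := sqrtr_nat_gt0 N; have z0 := sqrtr_nat_gt0 N.+1.
have y1 : 1 <= Num.sqrt N.+1%:R ^+ 2 :> R by rewrite sqrtr_nat_sqr ler1n.
have z2 : Num.sqrt N.+2%:R ^+ 2 = Num.sqrt N.+1%:R ^+ 2 + 1 :> R.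
  by rewrite !sqrtr_nat_sqr natr1.
move: IHN q0 qy uy u0 y0 z0 y1 z2.
set t := tsum R 0 N (k :: ks); set u := tsum R 0 N ks.
set y := Num.sqrt N.+1%:R; set z := Num.sqrt N.+2%:R; set q := _ ^- k.
move=> IHN q0 qy uy u0 y0 z0 y1 z2.
apply: (@le_trans _ _ (4 * C * (1 - y^-1) + C * y ^- 3)).
  apply: lerD => //; apply: (@le_trans _ _ (y ^- 4 * (C * y))).
    by apply: ler_pM.
  by rewrite le_eqVlt; apply/orP; left; apply/eqP; field; exact: lt0r_neq0.
rewrite -[4 * C]mulrC -!mulrA -mulrDr ler_wpM2l //.
rewrite -subr_ge0.
have -> : 4 * (1 - z^-1) - (4 * (1 - y^-1) + y ^- 3) =
  (4 * y ^+ 2 * (z - y) - z) / (y ^+ 3 * z).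
  by field; rewrite !lt0r_neq0.
rewrite divr_ge0 ?mulr_ge0 ?exprn_ge0 ?(ltW y0) ?(ltW z0) // subr_ge0.
have zy : 1 <= 2 * z * (z - y) by nra.
have z4 : z ^+ 2 <= 2 * y ^+ 2 by lra.
have yz : y <= z by nra.
have : z * (2 * z * (z - y)) <= 4 * y ^+ 2 * (z - y) by nra.
nra.
Qed.

Lemma tsum_cvg_admissible k ks : (1 < k)%N -> all (leq 1) ks ->
  tsum R 0 ^~ (k :: ks) @ \oo --> mtv R (k :: ks).
Proof.
move=> k1 /(tsum_le_admissible k1)[C le_C].
have /cvg_ex[l tl] : cvgn (tsum R 0 ^~ (k :: ks)).
  apply: nondecreasing_is_cvgn; first exact: tsum_nondecreasing.
  by exists C => _ [N _ <-].
by rewrite (mtv_cvg tl).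
Qed.

End Boundedness.

(** * Finite identities *)

Section FiniteIdentities.
Variable R : realType.

Lemma oddE m : (m.*2.+1)%:R = 2 * m%:R + 1 :> R.
Proof. by rewrite -natr1 -mul2n natrM. Qed.

(* The weights in prod_(m <= N) (1 - x^2/(2m+1)^2)^-1 =
   sum_(J <= N) (-1)^J pfw N J (2J+1) / ((2J+1)^2 - x^2). *)
Definition pfw (N J : nat) : R :=
  if (J <= N)%N then
    ((N.*2.+1)`!%:R ^+ 2) / (16 ^+ N * N`!%:R ^+ 2 * (N - J)`!%:R * (N + J).+1`!%:R)
  else 0.

Lemma pfw_ge0 N J : 0 <= pfw N J.
Proof.
by rewrite /pfw; case: ifP.
Qed.

Lemma pfw_out N J : (N < J)%N -> pfw N J = 0.
Proof. by rewrite /pfw ltnNge => /negbTE ->. Qed.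

Lemma pfw00 : pfw 0 0 = 1.
Proof.
rewrite /pfw leqnn expr0 -[(0.*2.+1)`!]/1%N.
by rewrite fact0 !expr1n !mulr1 divr1.
Qed.

Lemma fact_neq0 n : n`!%:R != 0 :> R.
Proof. by rewrite pnatr_eq0 -lt0n fact_gt0. Qed.

Lemma factSR n : (n.+1)`!%:R = n.+1%:R * n`!%:R :> R.
Proof. by rewrite factS natrM. Qed.

(** Removing the last factor of the product multiplies the residue at x = 2J+1 by the inverse of
    that factor there. For J = N+1 this vanishes, in agreement with the value 0 of [pfw] outside its
    range. *)
Lemma pfwSl N J : (J <= N.+1)%N ->
  pfw N.+1 J * (1 - (J.*2.+1)%:R ^+ 2 / (N.+1.*2.+1)%:R ^+ 2) = pfw N J.
Proof.
rewrite leq_eqVlt => /orP[/eqP ->|].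
  by rewrite divff ?subrr ?mulr0 ?pfw_out // sqrf_eq0 pnatr_eq0.
rewrite ltnS => JN; rewrite /pfw JN (leq_trans JN) //.
have [d ->] : exists d, N = (d + J)%N by exists (N - J)%N; rewrite subnK.
rewrite -addSn !addnK.
have -> : ((d.+1 + J).*2.+1 = (d + J).*2.+3)%N by lia.
have -> : ((d.+1 + J) + J).+1 = ((d + J) + J).+2 by lia.
rewrite addSn (factSR (d + J).*2.+2) (factSR (d + J).*2.+1) (factSR (d + J)).
rewrite (factSR d) (factSR (d + J + J).+1) [16 ^+ _]exprS.
have e4 : (d + J).+1%:R = d%:R + J%:R + 1 :> R by rewrite -natr1 natrD.
have e1 : ((d + J).*2.+3)%:R = 2 * (d%:R + J%:R) + 3 :> R.
  by rewrite -doubleS oddE e4; ring.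
have e2 : ((d + J).*2.+2)%:R = 2 * (d%:R + J%:R + 1) :> R.
  by rewrite -doubleS -mul2n natrM e4.
have e3 : (d + J + J).+2%:R = d%:R + 2 * J%:R + 2 :> R.
  by rewrite -natr1 -natr1 !natrD; ring.
have n1 : 2 * (d%:R + J%:R) + 3 != 0 :> R by rewrite -e1 pnatr_eq0.
have n3 : d%:R + 2 * J%:R + 2 != 0 :> R by rewrite -e3 pnatr_eq0.
have n4 : d%:R + J%:R + 1 != 0 :> R by rewrite -e4 pnatr_eq0.
have n5 : d%:R + 1 != 0 :> R by rewrite natr1 pnatr_eq0.
rewrite e1 e2 e3 e4 oddE -[d.+1%:R]natr1.
have f1 := fact_neq0 ((d + J).*2.+1); have f2 := fact_neq0 (d + J).
have f3 := fact_neq0 d; have f4 := fact_neq0 (d + J + J).+1.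
have f5 : 16 ^+ (d + J) != 0 :> R by rewrite expf_neq0 // pnatr_eq0.
field.
by do ?(apply/andP; split).
Qed.

(** The ratio of neighbouring weights. It drives both summations by parts below and shows that the
    limit of the weights does not depend on J. *)
Lemma pfwSr N J : (N.+1%:R + J.+1%:R) * pfw N J.+1 = (N%:R - J%:R) * pfw N J.
Proof.
have [NJ|JN] := leqP N J.
  rewrite pfw_out ?ltnS // mulr0; move: NJ; rewrite leq_eqVlt => /orP[/eqP->|NJ].
    by rewrite subrr mul0r.
  by rewrite pfw_out // mulr0.
rewrite /pfw JN (ltnW JN).
have [d ->] : exists d, N = (d + J.+1)%N by exists (N - J.+1)%N; rewrite subnK.
have -> : (d + J.+1 - J)%N = d.+1 by lia.
have -> : (d + J.+1 + J.+1).+1 = (d + J + J).+3 by lia.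
have -> : (d + J.+1 + J).+1 = (d + J + J).+2 by lia.
rewrite addnK (factSR d) (factSR (d + J + J).+2).
have e3 : (d + J + J).+3%:R = d%:R + 2 * J%:R + 3 :> R.
  by rewrite -3!natr1 !natrD; ring.
have e4 : (d + J.+1)%:R = d%:R + J%:R + 1 :> R by rewrite natrD -natr1 addrA.
have n3 : d%:R + 2 * J%:R + 3 != 0 :> R by rewrite -e3 pnatr_eq0.
have n5 : d%:R + 1 != 0 :> R by rewrite natr1 pnatr_eq0.
rewrite e3 -[(d + J.+1).+1%:R]natr1 e4 -[d.+1%:R]natr1 -[J.+1%:R]natr1.
have f2 := fact_neq0 (d + J.+1).
have f3 := fact_neq0 d; have f4 := fact_neq0 (d + J + J).+2.
have f5 : 16 ^+ (d + J.+1) != 0 :> R by rewrite expf_neq0 // pnatr_eq0.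
field.
by do ?(apply/andP; split).
Qed.


Definition pfsum N (g : nat -> R) := \sum_(J < N.+1) pfw N J * g J.

(** [pfwSl] summed over J. It has the shape of [tsum_consS] for an entry 2, with g losing two powers
    of 1/(2J+1); this makes the inductions on N match. *)
Lemma pfsumS N g : pfsum N.+1 g = pfsum N g +
  (N.+1.*2.+1)%:R ^- 2 * pfsum N.+1 (fun J => (J.*2.+1)%:R ^+ 2 * g J).
Proof.
have -> : pfsum N g = \sum_(J < N.+2) pfw N J * g J.
  by rewrite big_ord_recr /= pfw_out // mul0r addr0.
rewrite /pfsum mulr_sumr -big_split; apply: eq_bigr => J _ /=.
rewrite -(@pfwSl N J); last exact: (ltn_ord J).
have : (N.+1.*2.+1)%:R != 0 :> R by rewrite pnatr_eq0.
set c := (N.+1.*2.+1)%:R; set o := (J.*2.+1)%:R; set u := pfw _ _ => c0.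
by field.
Qed.

Lemma pfsum0 g : pfsum 0 g = g 0%N.
Proof. by rewrite /pfsum big_ord1 pfw00 mul1r. Qed.

(* Telescoping: (-1)^J w_J (2J+1) is the difference of (-1)^J w_J J (N+J+1) / N. *)
Lemma pfsum_alt_odd N : pfsum N.+1 (fun J => (-1) ^+ J * (J.*2.+1)%:R) = 0.
Proof.
have tel m : \sum_(J < m) pfw N.+1 J * ((-1) ^+ J * (J.*2.+1)%:R) =
    - (-1) ^+ m * pfw N.+1 m * m%:R * (N.+2%:R + m%:R) / N.+1%:R.
  elim: m => [|m IH]; first by rewrite big_ord0 mulr0 !mul0r.
  rewrite big_ord_recr /= IH exprS oddE.
  have := pfwSr N.+1 m; have n0 : N%:R + 1 != 0 :> R by rewrite natr1 pnatr_eq0.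
  rewrite -[N.+2%:R]natr1 -[N.+1%:R]natr1 -[m.+1%:R]natr1 => e.
  move: e; set u := pfw _ m; set v := pfw _ m.+1; set c := (-1) ^+ m => e.
  have -> : - (-1 * c) * v * (m%:R + 1) * (N%:R + 1 + 1 + (m%:R + 1)) / (N%:R + 1)
    = c * (m%:R + 1) * ((N%:R + 1 + 1 + (m%:R + 1)) * v) / (N%:R + 1) by field.
  by rewrite e; field.
by rewrite /pfsum tel pfw_out // mulr0 !mul0r.
Qed.

(** Terms of the Dirichlet beta series at s. *)
Definition altterm (s J : nat) : R := (-1) ^+ J * (J.*2.+1)%:R ^- s.

Definition altsum (s m : nat) : R := \sum_(J < m) altterm s J.

Lemma altsumS s m : altsum s m.+1 = altsum s m + altterm s m.
Proof. by rewrite /altsum big_ord_recr. Qed.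

Lemma altsum0 s : altsum s 0 = 0.
Proof. by rewrite /altsum big_ord0. Qed.

Lemma altterm0 s : altterm s 0 = 1.
Proof. by rewrite /altterm expr0 expr1n invr1 mulr1. Qed.

Lemma eq_pfsum N g h : g =1 h -> pfsum N g = pfsum N h.
Proof. by move=> gh; apply: eq_bigr => J _; rewrite gh. Qed.

Lemma oddX_neq0 m s : (m.*2.+1)%:R ^+ s != 0 :> R.
Proof. by rewrite expf_neq0 // pnatr_eq0. Qed.

Lemma sqr_oddXV m s : (m.*2.+1)%:R ^+ 2 * (m.*2.+1)%:R ^- s.+2 = (m.*2.+1)%:R ^- s :> R.
Proof. by rewrite -[s.+2]add2n exprD invfM mulrA divff ?mul1r ?oddX_neq0. Qed.

(** Both sides obey the same recursion in N. For b = 0 the left side is constantly 1, and the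
    increments on the right vanish by [pfsum_alt_odd]. *)
Lemma tsum_star_nseq2 b N : tsum R 1 N.+1 (nseq b 2) = pfsum N (altterm b.*2.+1).
Proof.
elim: b N => [|b IHb].
  elim=> [|N IHN]; first by rewrite pfsum0 altterm0.
  rewrite pfsumS -IHN (@eq_pfsum _ _ (fun J => (-1) ^+ J * (J.*2.+1)%:R)).
    by rewrite pfsum_alt_odd mulr0 addr0.
  by move=> J; rewrite /altterm mulrCA expr1 expr2 mulfK ?pnatr_eq0.
rewrite [nseq _ _]/=; elim=> [|N IHN].
  by rewrite tsum_consS tsum_cons0 add0r expr1n invr1 mul1r IHb !pfsum0 !altterm0.
rewrite tsum_consS IHN pfsumS addn1 IHb; congr (_ + _ * _).
by apply: eq_pfsum => J; rewrite /altterm mulrCA sqr_oddXV.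
Qed.

(* Abel summation with n (w_J - w_(J+1)) = (2J+1) w_J + (2J+3) w_(J+1), n = 2N+1. *)
Lemma pfsum_abel N (h : nat -> R) :
  pfsum N (fun I => (I.*2.+1)%:R * (\sum_(J < I) h J + \sum_(J < I.+1) h J)) =
  (N.*2.+1)%:R * pfsum N h.
Proof.
set A := fun m => \sum_(J < m) h J : R.
have abel m : \sum_(I < m) pfw N I * ((I.*2.+1)%:R * (A I + A I.+1)) =
    (N.*2.+1)%:R * (\sum_(J < m) pfw N J * h J)
    - A m * pfw N m * ((N.*2.+1)%:R + (m.*2.+1)%:R).
  elim: m => [|m IH]; first by rewrite !big_ord0 /A big_ord0 !mul0r mulr0 subr0.
  rewrite !big_ord_recr /= IH.
  have -> : A m.+1 = A m + h m by rewrite /A big_ord_recr.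
  have := pfwSr N m; rewrite !oddE -[N.+1%:R]natr1 -[m.+1%:R]natr1.
  set u := pfw _ m; set v := pfw _ m.+1 => e.
  have -> : (A m + h m) * v * (2 * N%:R + 1 + (2 * (m%:R + 1) + 1)) =
    2 * (A m + h m) * ((N%:R + 1 + (m%:R + 1)) * v) by ring.
  by rewrite e; ring.
by rewrite /pfsum abel pfw_out // mulr0 mul0r subr0.
Qed.

Lemma tsum_star_nseq2_1_nseq2 a b N :
  tsum R 1 N.+1 (nseq a 2 ++ 1%N :: nseq b 2) =
  pfsum N (fun I => (altsum b.*2.+1 I + altsum b.*2.+1 I.+1) * (I.*2.+1)%:R ^- a.*2.+1).
Proof.
have base (l : nat) : altsum l 0 + altsum l 1 = 1.
  by rewrite altsumS altsum0 !add0r altterm0.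
elim: a N => [|a IHa].
  rewrite cat0s; elim=> [|N IHN].
    rewrite tsum_consS tsum_cons0 add0r expr1n invr1 mul1r tsum_star_nseq2 !pfsum0.
    by rewrite altterm0 base expr1n invr1 mulr1.
  rewrite tsum_consS IHN pfsumS addn1 tsum_star_nseq2; congr (_ + _).
  (* The entry 1 supplies only one power of 1/(2N+3), whereas [pfsumS] asks for two. The second one
     is created here, and [pfsum_abel] absorbs the compensating factor 2N+3. *)
  rewrite -[pfsum _ (altterm _)](mulKf (oddX_neq0 N.+1 1)) !expr1 -pfsum_abel.
  rewrite mulrA expr2 invfM; congr (_ * _); apply: eq_pfsum => J.
  rewrite expr1 expr2 -mulrA; congr (_ * _).
  by rewrite mulrCA divff ?mulr1 ?pnatr_eq0.
rewrite [nseq _ _]/= cat_cons; elim=> [|N IHN].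
  rewrite tsum_consS tsum_cons0 add0r expr1n invr1 mul1r IHa !pfsum0.
  by rewrite !expr1n.
rewrite tsum_consS IHN pfsumS addn1 IHa; congr (_ + _ * _).
by apply: eq_pfsum => J; rewrite mulrCA sqr_oddXV.
Qed.

End FiniteIdentities.

(** * Limits *)

Section Limits.
Variable R : realType.
Local Notation h := (@harmonic R).

Lemma cvg_of_dist_le (u e : R ^nat) (l : R) :
  (forall n, `|l - u n| <= e n) -> e @ \oo --> 0 -> u @ \oo --> l.
Proof.
move=> le_e e0; apply/cvgrPdist_le => eps eps0.
have /cvgr_le/(_ _ eps0) := e0; apply: filterS => n; exact: le_trans.
Qed.

Lemma cauchy_rate_cvg (u e : R ^nat) :
  (forall m k, `|u (m + k)%N - u m| <= e m) -> e @ \oo --> 0 ->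
  u @ \oo --> limn u /\ forall m, `|limn u - u m| <= e m.
Proof.
move=> ue e0; have uc : u @ \oo --> limn u.
  apply: cauchy_cvg; apply: cauchy_exP => eps eps0.
  have /cvgrPdist_lt/(_ _ eps0) [m _ me] := e0.
  exists (u m), m => // n /= mn; rewrite /ball /= distrC -(subnKC mn).
  apply: le_lt_trans (ue m _) _; have := me m (leqnn m); rewrite sub0r normrN /=.
  exact: le_lt_trans (ler_norm _).
split=> // m; have uc' : (fun n => `|u n - u m|) @ \oo --> `|limn u - u m|.
  by apply: cvg_norm; apply: cvgB => //; exact: cvg_cst.
rewrite -(cvg_lim _ uc') //; apply: limr_le; first by apply/cvg_ex; eexists; exact: uc'.
by exists m => // n /= mn; rewrite -(subnKC mn); exact: ue.
Qed.

Lemma cvg_sum_seq (I : Type) (s : seq I) (f : I -> R ^nat) (l : I -> R) :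
  (forall i, f i @ \oo --> l i) ->
  (fun n => \sum_(i <- s) f i n) @ \oo --> \sum_(i <- s) l i.
Proof.
move=> fl; elim: s => [|i s IH].
  by rewrite big_nil; under eq_fun do rewrite big_nil; exact: cvg_cst.
by rewrite big_cons; under eq_fun do rewrite big_cons; exact: cvgD.
Qed.

Lemma alternating_tail_le (f : R ^nat) (m k : nat) :
  (forall J, 0 <= f J) -> (forall J, f J.+1 <= f J) ->
  `|\sum_(J < m + k) (-1) ^+ J * f J - \sum_(J < m) (-1) ^+ J * f J| <= f m.
Proof.
move=> f0 fS; pose S n := \sum_(J < n) (-1) ^+ J * f J; rewrite -/(S (m + k)%N) -/(S m).
(* The signed form, stated for all m, is what the induction on k can carry: peeling off the first
   term of the tail flips the sign. *)
suff: 0 <= (-1) ^+ m * (S (m + k)%N - S m) <= f m.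
  by move=> /andP[x0 xf]; rewrite -[leLHS]mul1r -(normr_sign _ m) -normrM ger0_norm.
elim: k m => [|k IH] m; first by rewrite addn0 subrr mulr0 lexx f0.
have SS : S m.+1 = S m + (-1) ^+ m * f m by rewrite /S big_ord_recr.
have cc : (-1) ^+ m * (-1) ^+ m = 1 :> R by rewrite -expr2 sqrr_sign.
have := IH m.+1; have := fS m; have := f0 m; rewrite addSnnS SS exprS.
move: cc; set c := (-1) ^+ m => cc.
have -> : c * (S (m + k.+1)%N - S m) =
    c * c * f m - -1 * c * (S (m + k.+1)%N - (S m + c * f m)) by ring.
by rewrite cc mul1r; set t := _ * (_ - _); lra.
Qed.

Lemma harmonicE m : h m = m.+1%:R^-1.
Proof. by []. Qed.

Lemma harmonic_gt0R m : 0 < h m. Proof. exact: harmonic_gt0. Qed.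

Lemma harmonicS_le m : h m.+1 <= h m.
Proof. by rewrite !harmonicE lef_pV2 ?posrE // ler_nat. Qed.

Lemma square_tail_le (g : R ^nat) (C : R) (m k : nat) :
  0 <= C -> (forall J, `|g J| <= C * h J ^+ 2) ->
  `|\sum_(J < m + k) g J - \sum_(J < m) g J| <= 2 * C * h m.
Proof.
move=> C0 gC.
(* Telescoping through (h n)^2 <= 2 (h n - h (n+1)). *)
suff : `|\sum_(J < m + k) g J - \sum_(J < m) g J| <= 2 * C * (h m - h (m + k)%N).
  by move/le_trans; apply; rewrite ler_wpM2l ?mulr_ge0 // gerBl ltW // harmonic_gt0R.
elim: k => [|k IH]; first by rewrite addn0 !subrr normr0 mulr0.
rewrite addnS big_ord_recr /= addrAC.
apply: le_trans (ler_normD _ _) _; apply: le_trans (lerD IH (gC _)) _.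
set n := (m + k)%N; rewrite -subr_ge0.
have -> : 2 * C * (h m - h n.+1) - (2 * C * (h m - h n) + C * h n ^+ 2) =
  C * (2 * (h n - h n.+1) - h n ^+ 2) by ring.
rewrite mulr_ge0 // !harmonicE.
have n0 : 0 < n.+1%:R :> R by [].
have -> : 2 * (n.+1%:R^-1 - n.+2%:R^-1) - n.+1%:R^-1 ^+ 2 =
   n%:R / (n.+1%:R ^+ 2 * n.+2%:R) :> R.
  by rewrite -[n.+2%:R]natr1 -[n.+1%:R]natr1; field;
     rewrite -natr1 in n0; rewrite ?lt0r_neq0 //; lra.
by rewrite divr_ge0 // mulr_ge0 // exprn_ge0.
Qed.

Lemma inv_oddX_le_harmonic k m : (0 < k)%N -> (m.*2.+1)%:R ^- k <= h m.
Proof. exact: inv_oddX_le_invS. Qed.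

Lemma inv_oddX_le_harmonic_sqr k m : (1 < k)%N -> (m.*2.+1)%:R ^- k <= h m ^+ 2.
Proof.
move=> k1; have k10 : (0 < k.-1)%N by lia.
have -> : k = (k.-1 + 1)%N by lia.
by rewrite exprD invfM expr2 ler_pM ?invr_ge0 ?exprn_ge0 // inv_oddX_le_harmonic.
Qed.

Lemma inv_oddX_ge0 k m : 0 <= (m.*2.+1)%:R ^- k :> R.
Proof. by rewrite invr_ge0 exprn_ge0. Qed.

Lemma inv_oddX_noninc k m : (m.+1.*2.+1)%:R ^- k <= (m.*2.+1)%:R ^- k :> R.
Proof.
rewrite lef_pV2 ?posrE ?exprn_gt0 // lerXn2r ?nnegrE // ler_nat; lia.
Qed.

Lemma altsum_tail s m k : `|altsum R s (m + k) - altsum R s m| <= (m.*2.+1)%:R ^- s.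
Proof.
by apply: (@alternating_tail_le (fun J => (J.*2.+1)%:R ^- s)) => J;
   [exact: inv_oddX_ge0|exact: inv_oddX_noninc].
Qed.

Lemma altsum_le1 s m : `|altsum R s m| <= 1.
Proof.
by have := altsum_tail s 0 m; rewrite altsum0 subr0 expr1n invr1 add0n.
Qed.

Definition dbeta s : R := limn (altsum R s).

Lemma altsum_cvg s : (0 < s)%N ->
  altsum R s @ \oo --> dbeta s /\ forall m, `|dbeta s - altsum R s m| <= h m.
Proof.
move=> s0; apply: cauchy_rate_cvg => [m k|]; last exact: cvg_harmonic.
exact: le_trans (altsum_tail _ _ _) (inv_oddX_le_harmonic _ s0).
Qed.

Lemma pfw_nonincr N J : pfw R N J.+1 <= pfw R N J.
Proof.
have [NJ|NJ] := leqP N J; first by rewrite pfw_out ?pfw_ge0.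
have := pfwSr R N J; have := pfw_ge0 R N J; have := pfw_ge0 R N J.+1.
set u := pfw _ _ J; set v := pfw _ _ J.+1 => v0 u0 e.
have J0 : 0 <= J%:R :> R by []. have N0 : 0 <= N%:R :> R by [].
move: e; rewrite -!natr1 => e.
have : 0 < N%:R + 1 + (J%:R + 1) :> R by lra.
move=> p; rewrite -(ler_pM2l p) e -subr_ge0.
have -> : (N%:R + 1 + (J%:R + 1)) * u - (N%:R - J%:R) * u = (2 * J%:R + 2) * u by ring.
by rewrite mulr_ge0 // addr_ge0 // mulr_ge0.
Qed.

Lemma pfw_nondecr N J : pfw R N J <= pfw R N.+1 J.
Proof.
have [NJ|NJ] := ltnP N J; first by rewrite pfw_out ?pfw_ge0.
rewrite -(@pfwSl _ N J); last exact: leqW.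
rewrite ler_piMr ?pfw_ge0 // gerBl divr_ge0 ?exprn_ge0 //.
Qed.

Lemma pfw_le0 N J : pfw R N J <= pfw R N 0.
Proof. by elim: J => [//|J]; apply: le_trans; exact: pfw_nonincr. Qed.

Lemma pfw_altterm_tail N s m k :
  `|\sum_(J < m + k) pfw R N J * altterm R s J - \sum_(J < m) pfw R N J * altterm R s J|
   <= pfw R N m * (m.*2.+1)%:R ^- s.
Proof.
under eq_bigr do rewrite /altterm mulrCA.
under [X in _ - X]eq_bigr do rewrite /altterm mulrCA.
apply: (@alternating_tail_le (fun J => pfw R N J * (J.*2.+1)%:R ^- s)) => J.
  by rewrite mulr_ge0 ?pfw_ge0 ?inv_oddX_ge0.
by rewrite ler_pM ?pfw_ge0 ?inv_oddX_ge0 ?pfw_nonincr ?inv_oddX_noninc.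
Qed.

Lemma pfsum_alt1 N : pfsum N (altterm R 1) = 1.
Proof. by rewrite -(tsum_star_nseq2 R 0). Qed.

(** The alternating sum [pfsum_alt1] equals 1 and its terms after the first amount to at most
    w_(N,1)/3 <= w_(N,0)/3, so even w_(N,0) <= 3/2. *)
Lemma pfw_le2 N J : pfw R N J <= 2.
Proof.
apply: le_trans (pfw_le0 N J) _.
have := pfw_altterm_tail N 1 1 N; rewrite add1n -/(pfsum _ _) pfsum_alt1.
rewrite big_ord1 altterm0 mulr1 expr1 -[(1.*2.+1)%:R]/(3%:R : R).
have := pfw_le0 N 1; have := pfw_ge0 R N 0; set u := pfw R N 0; set v := pfw R N 1.
by rewrite ler_norml => u0 vu /andP[H _]; lra.
Qed.

Definition pflim : R := limn (pfw R ^~ 0%N).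

(** For J = 0 the weights increase with N and are bounded. By [pfwSr] neighbouring weights differ by
    O(J/N), so the limit is the same for every J. *)
Lemma pfw_cvg J : pfw R ^~ J @ \oo --> pflim.
Proof.
elim: J => [|J IH].
  apply: nondecreasing_is_cvgn.
    by apply/nondecreasing_seqP => n; exact: pfw_nondecr.
  by exists 2 => _ [N _ <-]; exact: pfw_le2.
apply: (@cvg_of_dist_le _ (fun N => `|pflim - pfw R N J| + (2 * J.+1%:R * 2) * h N)).
  move=> N; have -> : pflim - pfw R N J.+1 = (pflim - pfw R N J) + (pfw R N J - pfw R N J.+1) by ring.
  apply: le_trans (ler_normD _ _) _; rewrite lerD2l.
  have := pfwSr R N J; have := pfw_ge0 R N J.+1; have := pfw_nonincr N J.
  have := pfw_le2 N J.
  set u := pfw R N J; set v := pfw R N J.+1 => u2 vu v0.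
  rewrite ger0_norm ?subr_ge0 // harmonicE ler_pdivlMr // -!natr1 => e.
  have J0 : 0 <= J%:R :> R by []. have N0 : 0 <= N%:R :> R by [].
  have: (u - v) * (N%:R + 1) <= (2 * J%:R + 1) * u + v by nra.
  nra.
have -> : 0 = `|pflim - pflim| + 2 * J.+1%:R * 2 * 0 :> R.
  by rewrite subrr normr0 mulr0 addr0.
apply: cvgD; first by apply: cvg_norm; apply: cvgB => //; exact: cvg_cst.
by apply: cvgM; [exact: cvg_cst|exact: cvg_harmonic].
Qed.

(* Dominated convergence for the weights, with a tail bound uniform in N. *)
Lemma pfsum_cvg (g : R ^nat) (G C : R) :
  (forall N m k, `|\sum_(J < m + k) pfw R N J * g J - \sum_(J < m) pfw R N J * g J|
     <= C * h m) ->
  (fun m => \sum_(J < m) g J) @ \oo --> G ->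
  (fun N => pfsum N g) @ \oo --> pflim * G.
Proof.
move=> tail gG.
have part N m : `|pfsum N g - \sum_(J < m) pfw R N J * g J| <= C * h m.
  have [Nm|mN] := leqP N.+1 m; last first.
    by rewrite /pfsum -(subnKC (ltnW mN)); exact: tail.
  suff -> : pfsum N g = \sum_(J < m) pfw R N J * g J.
    by have := tail N m 0%N; rewrite addn0.
  rewrite -(subnKC Nm); elim: (m - _)%N => [|k IH]; first by rewrite addn0.
  by rewrite addnS big_ord_recr /= -IH pfw_out ?mul0r ?addr0 // leq_addr.
have Ch0 : (fun m => C * h m) @ \oo --> 0.
  by rewrite -(mulr0 C); apply: cvgM; [exact: cvg_cst|exact: cvg_harmonic].
apply/cvgrPdist_le => eps eps0; have e30 : 0 < eps / 3 by lra.
have [m [Cm Gm]] : exists m, C * h m <= eps / 3 /\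
    `|pflim * G - pflim * \sum_(J < m) g J| <= eps / 3.
  have cG : (fun m => pflim * \sum_(J < m) g J) @ \oo --> pflim * G.
    by apply: cvgM => //; exact: cvg_cst.
  have /cvgr_le/(_ _ e30)[a _ Ha] := Ch0.
  have /cvgrPdist_le/(_ _ e30)[b _ Hb] := cG.
  by exists (maxn a b); split; [apply: Ha => /=|apply: Hb => /=]; rewrite leq_max leqnn ?orbT.
have : (fun N => \sum_(J < m) pfw R N J * g J) @ \oo --> pflim * \sum_(J < m) g J.
  rewrite mulr_sumr; apply: cvg_sum_seq => J.
  by apply: cvgM; [exact: pfw_cvg|exact: cvg_cst].
move=> /cvgrPdist_le/(_ _ e30); apply: filterS => N HN.
have := part N m; rewrite distrC => HP.
move: Gm HN HP Cm; set x := pflim * G; set y := pflim * _; set z := \sum_(_ < _) _.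
set w := pfsum _ _; rewrite !ler_norml => /andP[? ?] /andP[? ?] /andP[? ?] ?.
apply/andP; split; lra.
Qed.

End Limits.

(** * Limits of the truncated star sums *)

Section StarLimits.
Variable R : realType.
Local Notation h := (@harmonic R).
Local Notation L := (pflim R).

Definition nested_alt (a b I : nat) : R :=
  (altsum R b.*2.+1 I + altsum R b.*2.+1 I.+1) * (I.*2.+1)%:R ^- a.*2.+1.

Definition nested_altsum (a b M : nat) : R := \sum_(I < M) nested_alt a b I.

Lemma tsum_star_nseq2_cvg b :
  tsum R 1 ^~ (nseq b 2%N) @ \oo --> L * dbeta R b.*2.+1.
Proof.
rewrite -cvg_shiftS /=; under eq_fun do rewrite tsum_star_nseq2.
apply: (@pfsum_cvg _ _ _ 2); last by have [] := altsum_cvg R (ltn0Sn b.*2).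
move=> N m k; apply: le_trans (pfw_altterm_tail _ _ _ _ _) _.
by rewrite ler_pM ?pfw_ge0 ?inv_oddX_ge0 ?pfw_le2 // inv_oddX_le_harmonic.
Qed.

(** The case b = 0 of the previous limit, in which every truncated sum is 1. *)
Lemma pflim_dbeta1 : L * dbeta R 1 = 1.
Proof.
rewrite -[1%N]/(0.*2.+1) -(cvg_lim _ (@tsum_star_nseq2_cvg 0%N)) //.
exact: lim_cst.
Qed.

Lemma pfsum_cvg_square (g : R ^nat) (G C : R) : 0 <= C ->
  (forall J, `|g J| <= C * h J ^+ 2) ->
  (fun m => \sum_(J < m) g J) @ \oo --> G ->
  (fun N => pfsum N g) @ \oo --> L * G.
Proof.
move=> C0 gC; apply: (@pfsum_cvg _ _ _ (2 * (2 * C))) => N m k.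
apply: (@square_tail_le _ (fun J => pfw R N J * g J)) => [|J]; first exact: mulr_ge0.
rewrite normrM ger0_norm ?pfw_ge0 // -mulrA ler_pM ?pfw_ge0 ?pfw_le2 //.
Qed.

Lemma norm_addr_le (x y : R) (c : R) : `|x| <= c -> `|y| <= c -> `|x + y| <= 2 * c.
Proof. by move=> xc yc; apply: le_trans (ler_normD _ _) _; lra. Qed.

(** With at least one leading 2 the exponent of 1/(2I+1) is at least 3 and the inner sums are
    bounded, so the terms are dominated by a multiple of 1/I^2. *)
Lemma tsum_star_nseq2_1_nseq2_cvg a b G :
  nested_altsum a.+1 b @ \oo --> G ->
  tsum R 1 ^~ (nseq a.+1 2 ++ 1 :: nseq b 2)%N @ \oo --> L * G.
Proof.
move=> cG; rewrite -cvg_shiftS.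
have -> : [sequence tsum R 1 n.+1 (nseq a.+1 2 ++ 1%N :: nseq b 2)]_n =
    (fun N => pfsum N (nested_alt a.+1 b)).
  by apply/funext => N; exact: (tsum_star_nseq2_1_nseq2 R a.+1).
apply: (@pfsum_cvg_square _ _ 2) => // J.
rewrite normrM [`|_ ^-1|]ger0_norm ?inv_oddX_ge0 // ler_pM //.
  by rewrite -[2]mulr1 norm_addr_le ?altsum_le1.
exact: inv_oddX_le_harmonic_sqr.
Qed.

(** The Cesàro means of 1/n tend to 0, which expresses log N / N -> 0. *)
Lemma harmonic_series_small : (fun N => h N * \sum_(J < N.+1) h J) @ \oo --> 0.
Proof.
have := @cesaro R h 0 cvg_harmonic; rewrite /arithmetic_mean /=.
by under eq_fun do rewrite seriesEord.
Qed.

(** A rate O(1/N) is needed because this error gets multiplied by the logarithmically divergent odd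
    harmonic sum. *)
Lemma tsum_star_nseq2_rate b : exists2 C : R, 0 <= C &
  forall N, `|L * dbeta R b.*2.+1 - tsum R 1 N.+1 (nseq b 2%N)| <= C * h N.
Proof.
case: b => [|b]; first by exists 0 => // N; rewrite pflim_dbeta1 subrr normr0 mul0r.
have cb := @tsum_star_nseq2_cvg b; set B := L * _ in cb.
have tB N : tsum R 1 N (nseq b 2%N) <= B.
  rewrite -(cvg_lim _ cb) //; apply: nondecreasing_cvgn_le.
    exact: tsum_nondecreasing.
  by apply/cvg_ex; exists B.
have B0 : 0 <= B := le_trans (tsum_ge0 _ _ _ _) (tB 0%N).
exists (2 * B) => [|N]; first exact: mulr_ge0.
have cb1 := @tsum_star_nseq2_cvg b.+1.
have rate : forall m k, `|tsum R 1 (m + k) (nseq b.+1 2%N) - tsum R 1 m (nseq b.+1 2%N)|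
    <= 2 * B * h m.
  move=> m k; apply: (@square_tail_le _ (fun J => (J.*2.+1)%:R ^- 2 * tsum R 1 (J + 1) (nseq b 2%N))) => // J.
  rewrite normrM !ger0_norm ?inv_oddX_ge0 ?tsum_ge0 // mulrC ler_pM ?inv_oddX_ge0 ?tsum_ge0 //.
  exact: inv_oddX_le_harmonic_sqr.
have h0 : (fun m => 2 * B * h m) @ \oo --> 0.
  by rewrite -(mulr0 (2 * B)); apply: cvgM; [exact: cvg_cst|exact: cvg_harmonic].
have [_ H] := cauchy_rate_cvg rate h0.
rewrite -(cvg_lim _ cb1) //; apply: le_trans (H _) _.
by rewrite ler_wpM2l ?harmonicS_le // mulr_ge0.
Qed.

(** [nested_alt 0 c J] is 2 beta(2c+1)/(2J+1) up to O(1/J^2). The leading parts cancel because L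
    beta(1) = 1. *)
Lemma nested_alt_diff_le b J :
  `|nested_alt 0 b J - L * dbeta R b.*2.+1 * nested_alt 0 0 J| <=
  2 * (1 + `|L * dbeta R b.*2.+1|) * h J ^+ 2.
Proof.
have dist c I : `|altsum R c.*2.+1 I + altsum R c.*2.+1 I.+1 - 2 * dbeta R c.*2.+1|
    <= 2 * h I.
  have [_ H] := altsum_cvg R (ltn0Sn c.*2).
  set x := altsum _ _ _; set y := altsum _ _ _; set z := dbeta _ _.
  have -> : x + y - 2 * z = - (z - x) + - (z - y) by ring.
  apply: norm_addr_le; rewrite normrN // (le_trans (H _)) // harmonicS_le //.
rewrite /nested_alt; set B := L * _.
have e : B * (2 * dbeta R 1) = 2 * dbeta R b.*2.+1.
  by rewrite mulrCA /B mulrAC pflim_dbeta1 mul1r.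
set x := altsum R b.*2.+1 J + _; set y := altsum R 0.*2.+1 J + _; set o := _ ^- _.
have -> : x * o - B * (y * o) =
    ((x - 2 * dbeta R b.*2.+1) + - B * (y - 2 * dbeta R 1)) * o.
  by rewrite -e; ring.
rewrite normrM [`|o|]ger0_norm ?inv_oddX_ge0 // expr2 mulrA ler_pM ?inv_oddX_ge0 //; last first.
  exact: inv_oddX_le_harmonic.
apply: le_trans (ler_normD _ _) _.
have := dist b J; have := ler_wpM2l (normr_ge0 (- B)) (dist 0%N J).
by rewrite -normrM normrN -/x -/y; set u := `|_|; set v := `|x - _|; lra.
Qed.

Lemma tsum_star_1_nseq2_cvg b G :
  (fun M => nested_altsum 0 b M - L * dbeta R b.*2.+1 * nested_altsum 0 0 M) @ \oo --> G ->
  (fun N => tsum R 1 N (1 :: nseq b 2)%N - tsum R 1 N [:: 1%N] * tsum R 1 N (nseq b 2%N))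
    @ \oo --> L * G.
Proof.
move=> cG; rewrite -cvg_shiftS /=; set B := L * dbeta R b.*2.+1 in cG *.
(* The weighted sum of the convergent combination, plus the error of P_N(b) times U_N(0,0), which is
   O(log N / N). *)
have -> : (fun N => tsum R 1 N.+1 (1 :: nseq b 2)%N
      - tsum R 1 N.+1 [:: 1%N] * tsum R 1 N.+1 (nseq b 2%N)) =
  (fun N => pfsum N (fun J => nested_alt 0 b J - B * nested_alt 0 0 J)
    + (B - tsum R 1 N.+1 (nseq b 2%N)) * tsum R 1 N.+1 [:: 1%N]).
  apply/funext => N.
  have Eb : tsum R 1 N.+1 (1 :: nseq b 2)%N = pfsum N (nested_alt 0 b).
    exact: (tsum_star_nseq2_1_nseq2 R 0).
  have E0 : tsum R 1 N.+1 [:: 1%N] = pfsum N (nested_alt 0 0).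
    exact: (tsum_star_nseq2_1_nseq2 R 0 0).
  have -> : pfsum N (fun J => nested_alt 0 b J - B * nested_alt 0 0 J) =
      pfsum N (nested_alt 0 b) - B * pfsum N (nested_alt 0 0).
    by rewrite /pfsum mulr_sumr -sumrB; apply: eq_bigr => J _; ring.
  by rewrite Eb E0; ring.
have [C C0 rate] := tsum_star_nseq2_rate b; rewrite -/B in rate.
rewrite -[L * G]addr0; apply: cvgD.
  apply: (@pfsum_cvg_square _ _ (2 * (1 + `|B|))).
  - by rewrite mulr_ge0 // addr_ge0.
  - exact: nested_alt_diff_le.
  - apply: cvg_trans cG; apply: near_eq_cvg; apply: nearW => M /=.
    by rewrite sumrB -mulr_sumr.
apply: (@cvg_of_dist_le _ _ (fun N => C * (h N * \sum_(J < N.+1) h J))); last first.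
  rewrite -[X in _ --> X](mulr0 C).
  by apply: cvgM; [exact: cvg_cst|exact: harmonic_series_small].
move=> N; rewrite sub0r normrN normrM mulrA ler_pM //.
rewrite ger0_norm ?tsum_ge0 //=; apply: ler_sum => J _.
by rewrite mulr1 inv_oddX_le_harmonic.
Qed.
End StarLimits.

(** * Partial fractions of the double sum *)

Section PartialFractions.
Variable R : fieldType.

(** Iteration of 1/(xy) = (1/x + 1/y)/(x + y); the coefficients follow Pascal's rule. *)
Lemma partial_fractions (x y : R) P Q : x != 0 -> y != 0 -> x + y != 0 ->
  x ^- P.+1 * y ^- Q.+1 =
  \sum_(r < (P + Q).+1) (x + y) ^- r.+1 *
    ('C(r, P)%:R * y ^- ((P + Q).+1 - r) + 'C(r, Q)%:R * x ^- ((P + Q).+1 - r)).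
Proof.
move=> x0 y0 k0.
have step p q : x ^- p.+2 * y ^- q.+2 =
    (x + y)^-1 * (x ^- p.+1 * y ^- q.+2 + x ^- p.+2 * y ^- q.+1).
  have xp := expf_neq0 p.+1 x0; have yq := expf_neq0 q.+1 y0.
  rewrite [x ^+ p.+2]exprS [y ^+ q.+2]exprS.
  by field; rewrite k0 x0 y0 xp yq.
(* [step] only lowers exponents that are at least 2, so an exponent 1 needs its own induction. *)
have edge (u v : R) q : u != 0 -> v != 0 -> u + v != 0 -> u^-1 * v ^- q.+1 =
    \sum_(r < q.+1) (u + v) ^- r.+1 *
      (v ^- (q.+1 - r) + 'C(r, q)%:R * u ^- (q.+1 - r)).
  move=> u0 v0 uv0; elim: q => [|q IH].
    by rewrite big_ord1 bin0 subn0 !expr1; field; rewrite u0 v0 uv0.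
  have -> : u^-1 * v ^- q.+2 = (u + v)^-1 * (v ^- q.+2 + u^-1 * v ^- q.+1).
    have vQ := expf_neq0 q.+1 v0; rewrite [v ^+ q.+2]exprS.
    by field; rewrite u0 v0 uv0 vQ.
  rewrite IH [in RHS]big_ord_recl /= subn0 bin0n /= mul0r addr0 expr1 mulrDr; congr (_ + _).
  rewrite mulr_sumr; apply: eq_bigr => r _; rewrite /bump /= add1n subSS.
  rewrite [_ ^+ r.+2]exprS invfM -mulrA; congr (_ * (_ * (_ + _))).
  by rewrite binS (bin_small (ltn_ord r)) add0n.
elim: P Q => [|P IHP] Q.
  rewrite expr1 edge // add0n; apply: eq_bigr => r _.
  by rewrite bin0 mul1r.
elim: Q => [|Q IHQ].
  rewrite expr1 mulrC edge //; last by rewrite addrC.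
  rewrite addn0; apply: eq_bigr => r _.
  by rewrite bin0 mul1r [y + x]addrC; congr (_ * _); rewrite addrC.
rewrite step IHP IHQ [in RHS]big_ord_recl /= !bin0n /= !mul0r addr0 mulr0 add0r.
rewrite addSnnS -big_split mulr_sumr; apply: eq_bigr => r _ /=.
rewrite /bump /= add1n subSS !binS !natrD -[(P.+1 + Q.+1 - r)%N]/((P + Q.+1).+1 - r)%N.
rewrite [_ ^+ r.+2]exprS invfM; ring.
Qed.

End PartialFractions.

(** * Symmetrizing the double sum and summing along i + j = k *)

Section Rearrangement.
Variable R : realType.

(* cnode M t, for t < 2M, lists the odd integers from -(2M-1) to 2M-1;
   (-1)^(t+M) is the nontrivial character mod 4 evaluated at cnode M t. *)
Definition cnode (M t : nat) : R := (t.*2.+1)%:R - (M.*2)%:R.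

Definition window (s M lo hi : nat) : R :=
  \sum_(lo <= t < hi) (-1) ^+ (t + M) * cnode M t ^- s.

Lemma cnodeD M J : cnode M (M + J) = (J.*2.+1)%:R.
Proof. by rewrite /cnode doubleD -addnS natrD addrAC subrr add0r. Qed.

Lemma cnodeB M J : (J < M)%N -> cnode M (M - J.+1) = - (J.*2.+1)%:R.
Proof.
move=> JM; apply/eqP; rewrite /cnode -subr_eq0 opprK addrAC -natrD subr_eq0 eqr_nat.
by apply/eqP; lia.
Qed.

Lemma cnode_neq0 M t : cnode M t != 0.
Proof. by rewrite /cnode subr_eq0 eqr_nat; lia. Qed.

Lemma signr_double n : (-1) ^+ n.*2 = 1 :> R.
Proof. by rewrite -mul2n exprM sqrrN !expr1n. Qed.

Lemma signrDD (J M : nat) : (-1) ^+ (J + M + M) = (-1) ^+ J :> R.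
Proof. by rewrite -addnA addnn exprD signr_double mulr1. Qed.

Lemma window_hi s M m : window s M M (M + m) = altsum R s m.
Proof.
rewrite /window -{1}[M]add0n big_addn addKn big_mkord; apply: eq_bigr => J _.
by rewrite signrDD addnC cnodeD.
Qed.

(** Reflection at 0: the character is odd and the power contributes (-1)^s. *)
Lemma window_lo s M m : (m <= M)%N ->
  window s M (M - m) M = (-1) ^+ s.+1 * altsum R s m.
Proof.
elim: m => [|m IH] mM; first by rewrite /window subn0 big_geq // altsum0 mulr0.
rewrite /window big_ltn; last by lia.
rewrite subnSK // -/(window _ _ _ _) IH ?(ltnW mM) // altsumS mulrDr addrC.
congr (_ + _); rewrite cnodeB // /altterm (exprNn (m.*2.+1)%:R) invfM -[(-1) ^- s]exprVn invrN1.
have -> : (-1) ^+ (M - m.+1 + M) = - (-1) ^+ m :> R.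
  rewrite -[RHS]mulN1r -exprS -(signrDD m.+1 (M - m.+1)); congr (_ ^+ _); lia.
by rewrite exprS; ring.
Qed.

Lemma window_cat s M l m n : (l <= m)%N -> (m <= n)%N ->
  window s M l n = window s M l m + window s M m n.
Proof. by move=> lm mn; rewrite /window (big_cat_nat_idem _ lm mn) //; exact: addr0. Qed.

Lemma window_around s M m : (m <= M)%N ->
  window s M (M - m) M.*2 = altsum R s M + (-1) ^+ s.+1 * altsum R s m.
Proof.
move=> mM; rewrite (@window_cat _ _ _ M) ?leq_subr -?addnn ?leq_addr //.
by rewrite window_lo // window_hi addrC.
Qed.

Lemma window_above s M m : (m <= M)%N ->
  window s M (M + m) M.*2 = altsum R s M - altsum R s m.
Proof.
move=> mM; apply/eqP; rewrite eq_sym subr_eq addrC -(window_hi s M M) -(window_hi s M m).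
by rewrite addnn -window_cat ?leq_addr //; lia.
Qed.

Lemma sum_double (F : nat -> R) M :
  \sum_(0 <= t < M.*2) F t = \sum_(I < M) (F (M - I.+1)%N + F (M + I)%N).
Proof.
rewrite (@big_cat_nat _ _ _ M) ?leq_addr -?addnn ?leq_addr //= big_split.
rewrite big_nat_rev big_mkord /=; congr (_ + _).
by rewrite -{1}[M]add0n big_addn addnK big_mkord; apply: eq_bigr => I _; rewrite addnC.
Qed.

(** The inner window consists of the odd j with i + j > 0. Pairing i = 2I+1 with i = -(2I+1), whose
    odd powers differ by a sign, cancels the full half-line sums and leaves s_b(I). *)
Lemma nested_altsum_window a b M : nested_altsum R a b M =
  \sum_(0 <= t < M.*2) cnode M t ^- a.*2.+1 * window b.*2.+1 M (M.*2 - t) M.*2.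
Proof.
rewrite sum_double; apply: eq_bigr => I _ /=; rewrite cnodeB //.
have -> : (M.*2 - (M - I.+1) = M + I.+1)%N by have := ltn_ord I; lia.
have -> : (M.*2 - (M + I) = M - I)%N by lia.
rewrite window_above // window_around; last exact: ltnW.
rewrite cnodeD (exprNn (I.*2.+1)%:R) invfM -[(-1) ^- _]exprVn invrN1.
rewrite [(-1) ^+ b.*2.+2]exprS 2![(-1) ^+ _.*2.+1]exprS !signr_double /nested_alt.
ring.
Qed.

(** The new outer variable is u = i + j + 1 - n. For positions of nodes, with n = 2M, the sum of the
    two nodes is k = 2u. *)
Lemma exchange_triangle n (F : nat -> nat -> R) :
  \sum_(0 <= i < n) \sum_(n - i <= j < n) F i j =
  \sum_(1 <= u < n) \sum_(u <= j < n) F (u + (n.-1 - j))%N j.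
Proof.
transitivity (\sum_(0 <= j < n) \sum_(n - j <= i < n) F i j).
  transitivity (\sum_(0 <= i < n) \sum_(0 <= j < n | (n <= i + j)%N) F i j).
    apply: eq_big_nat => i /andP[_ ilt]; rewrite (big_nat_widenl _ 0) //.
    by apply: eq_bigl => j; lia.
  under eq_bigr do rewrite big_mkcond.
  rewrite exchange_big_nat; apply: eq_big_nat => j /andP[_ jn].
  rewrite -big_mkcond [in RHS](big_nat_widenl _ 0) //.
  by apply: eq_bigl => i; lia.
transitivity (\sum_(0 <= j < n) \sum_(1 <= u < j.+1) F (u + (n.-1 - j))%N j).
  apply: eq_big_nat => j /andP[_ jn].
  have -> : (n - j = 1 + (n.-1 - j))%N by lia.
  by rewrite big_addn; have -> : (n - (n.-1 - j) = j.+1)%N by lia.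
transitivity (\sum_(0 <= j < n) \sum_(1 <= u < n | (u <= j)%N) F (u + (n.-1 - j))%N j).
  by apply: eq_big_nat => j /andP[_ jn]; rewrite (big_nat_widen _ _ n).
under eq_bigr do rewrite big_mkcond.
rewrite exchange_big_nat; apply: eq_big_nat => u /andP[_ un].
by rewrite -big_mkcond [in RHS](big_nat_widenl _ 0).
Qed.

Lemma nested_altsum_partial_fractions a b M :
  nested_altsum R a b M = \sum_(1 <= u < M.*2) \sum_(r < (a.*2 + b.*2).+1)
    (u.*2)%:R ^- r.+1 * ('C(r, a.*2)%:R - (-1) ^+ u * 'C(r, b.*2)%:R) *
    window ((a.*2 + b.*2).+1 - r) M u M.*2.
Proof.
rewrite nested_altsum_window.
under eq_bigr do rewrite /window mulr_sumr.
rewrite exchange_triangle; apply: eq_big_nat => u /andP[u0 uM].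
set n := (a.*2 + b.*2).+1.
(* For fixed u, reversing the range swaps the two nodes. Since they add up to 2u, the character
   changes by -(-1)^u. *)
have flip (s : nat) : \sum_(u <= t < M.*2) (-1) ^+ (t + M) * cnode M (u + (M.*2.-1 - t)) ^- s
    = - (-1) ^+ u * window s M u M.*2.
  rewrite big_nat_rev /window mulr_sumr; apply: eq_big_nat => t /andP[ut tM].
  have -> : (u + (M.*2.-1 - (u + M.*2 - t.+1)) = t)%N by lia.
  rewrite mulrA; congr (_ * _); rewrite -[- (-1) ^+ u]mulN1r -exprS -exprD.
  rewrite -signr_odd -[RHS]signr_odd; congr (_ ^+ _); congr nat_of_bool; lia.
transitivity (\sum_(u <= t < M.*2) \sum_(r < n) (u.*2)%:R ^- r.+1 *
   ('C(r, a.*2)%:R * ((-1) ^+ (t + M) * cnode M t ^- (n - r)) +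
    'C(r, b.*2)%:R * ((-1) ^+ (t + M) * cnode M (u + (M.*2.-1 - t)) ^- (n - r)))).
  apply: eq_big_nat => t /andP[ut tM].
  have e : cnode M (u + (M.*2.-1 - t)) + cnode M t = (u.*2)%:R.
    apply/eqP; rewrite /cnode addrACA -opprD subr_eq -!natrD eqr_nat; apply/eqP; lia.
  rewrite mulrCA partial_fractions ?cnode_neq0 // ?e ?pnatr_eq0 //; last by lia.
  by rewrite mulr_sumr; apply: eq_bigr => r _; ring.
rewrite exchange_big; apply: eq_bigr => r _.
rewrite -mulr_sumr big_split /= -!mulr_sumr flip -/(window _ _ _ _); ring.
Qed.

End Rearrangement.

(** * Limit of the rearranged double sum *)

Section DoubleSumLimit.
Variable R : realType.
Local Notation h := (@harmonic R).

(** For u <= M the window reaches the centre from both sides, and by parity the halves add up for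
    odd s and cancel for even s. For u > M only a tail remains. *)
Definition window_lim (s M u : nat) : R :=
  if (u <= M)%N && odd s then 2 * dbeta R s else 0.

(** The errors are alternating tails starting at distance |u - M| from the centre; with truncated
    subtraction this distance is the sum [M - u + (u - M)]. *)
Lemma window_dist_le s M u : (0 < s)%N -> (u <= M.*2)%N ->
  `|window R s M u M.*2 - window_lim s M u| <= 2 * h (M - u + (u - M))%N.
Proof.
move=> s0 uM; have [_ beta] := altsum_cvg R s0.
have hd m : (m <= M)%N -> h M <= h m.
  by move=> mM; rewrite !harmonicE lef_pV2 ?posrE // ler_nat.
have diff m : (m <= M)%N -> `|altsum R s M - altsum R s m| <= 2 * h m.
  move=> mM; rewrite -(subnKC mM); apply: le_trans (altsum_tail _ _ _ _) _.
  have := inv_oddX_le_harmonic R m s0; have := harmonic_gt0R R m; lra.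
rewrite /window_lim; have [le_uM|lt_Mu] := leqP u M => /=.
  have e : (M - u + (u - M) = M - u)%N by lia.
  rewrite -{1}(subKn le_uM) window_around ?leq_subr // e -signr_odd /=.
  case: ifP => os; last by rewrite expr1 mulN1r subr0 diff // leq_subr.
  rewrite expr0 mul1r; set x := altsum _ _ _; set y := altsum _ _ _.
  have -> : x + y - 2 * dbeta R s = - (dbeta R s - x) + - (dbeta R s - y) by ring.
  by apply: norm_addr_le; rewrite normrN ?(le_trans (beta _)) // hd // leq_subr.
have e : (M - u + (u - M) = u - M)%N by lia.
rewrite -{1}(subnKC (ltnW lt_Mu)) window_above; last by lia.
by rewrite e subr0 diff //; lia.
Qed.

(** For u <= M, 1/(u (M+1-u)) = (1/u + 1/(M+1-u))/(M+1) gives two harmonic sums. For u > M, 1/u <=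
    1/(M+1) gives the third. *)
Lemma harmonic_conv_le M :
  \sum_(1 <= u < M.*2) u%:R^-1 * h (M - u + (u - M))%N <=
  3 * (h M * \sum_(J < M.+1) h J).
Proof.
case: M => [|M].
  by rewrite big_geq // !mulr_ge0 // ?harmonic_ge0 // sumr_ge0 // => J _; exact: harmonic_ge0.
set H := \sum_(J < _) _.
have HE : H = \sum_(0 <= J < M.+2) h J by rewrite big_mkord.
have h0 J : 0 <= h J by exact: harmonic_ge0.
have HM : \sum_(0 <= J < M.+1) h J <= H by rewrite HE [leRHS]big_nat_recr //= lerDl.
rewrite (@big_cat_nat _ _ _ M.+2) //=; last by lia.
have -> : 3 * (h M.+1 * H) = h M.+1 * (H + H) + h M.+1 * H by ring.
apply: lerD.
  apply: (@le_trans _ _ (h M.+1 * (\sum_(0 <= J < M.+1) h J + \sum_(0 <= J < M.+1) h J))).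
    rewrite [X in _ + X]big_nat_rev /= add0n -big_split big_add1 /= mulr_sumr.
    apply: ler_sum_nat => J /andP[_ JM].
    have -> : (M.+1 - J.+1 + (J.+1 - M.+1) = M.+1 - J.+1)%N by lia.
    have eM : M.+2%:R = J.+1%:R + (M.+1 - J.+1).+1%:R :> R.
      by rewrite -natrD; congr _%:R; lia.
    have J0 : J.+1%:R != 0 :> R by rewrite pnatr_eq0.
    have J1 : (M.+1 - J.+1).+1%:R != 0 :> R by rewrite pnatr_eq0.
    have M0 : M.+2%:R != 0 :> R by rewrite pnatr_eq0.
    rewrite le_eqVlt; apply/orP; left; apply/eqP.
    move: J0 J1 M0; rewrite eM; move: (J.+1%:R) ((_ - _).+1%:R) => x y J0 J1 M0.
    by field; rewrite J0 J1 M0.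
  by rewrite ler_wpM2l // lerD.
have -> : (M.+1.*2 = M + M.+2)%N by lia.
rewrite -{1}[M.+2]add0n big_addn addnK.
apply: (@le_trans _ _ (\sum_(0 <= J < M) h M.+1 * h J)).
  apply: ler_sum_nat => J /andP[_ JM]; rewrite ler_pM ?invr_ge0 //.
    by rewrite harmonicE lef_pV2 ?posrE ?ltr0n ?ler_nat; lia.
  by rewrite !harmonicE lef_pV2 ?posrE ?ltr0n // ler_nat; lia.
rewrite -mulr_sumr ler_wpM2l //; apply: le_trans HM.
by rewrite [leRHS]big_nat_recr //= lerDl.
Qed.

Definition even_zeta (r M : nat) : R := \sum_(v < M) (v.+1.*2)%:R ^- r.*2.+1.

Definition even_eta (r M : nat) : R := \sum_(v < M) (-1) ^+ v * (v.+1.*2)%:R ^- r.*2.+1.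

(** The double sum with each window replaced by its limit, as [beta_zeta_sumE] confirms. *)
Definition beta_zeta_sum (a b M : nat) : R :=
  \sum_(r < (a + b).+1) 2 * dbeta R (a + b - r).*2.+1 *
    ('C(r.*2, a.*2)%:R * even_zeta r M + 'C(r.*2, b.*2)%:R * even_eta r M).

Lemma sum_even_terms (F : nat -> R) m :
  \sum_(r < m.*2.+1) (if odd r then 0 else F r) = \sum_(r < m.+1) F r.*2.
Proof.
elim: m => [|m IH]; first by rewrite !big_ord1.
by rewrite big_ord_recr big_ord_recr [RHS]big_ord_recr /= IH odd_double addr0.
Qed.

(** For odd r the window exponent is even and its limit 0, so only even r survive; likewise only u
    <= M contribute. *)
Lemma beta_zeta_sumE a b M : beta_zeta_sum a b M =
  \sum_(1 <= u < M.*2) \sum_(r < (a.*2 + b.*2).+1)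
    (u.*2)%:R ^- r.+1 * ('C(r, a.*2)%:R - (-1) ^+ u * 'C(r, b.*2)%:R) *
    window_lim ((a.*2 + b.*2).+1 - r) M u.
Proof.
rewrite exchange_big /= -doubleD.
pose F r := \sum_(1 <= u < M.+1)
    (u.*2)%:R ^- r.+1 * ('C(r, a.*2)%:R - (-1) ^+ u * 'C(r, b.*2)%:R) *
    (2 * dbeta R ((a + b).*2.+1 - r)).
rewrite [RHS](eq_bigr (fun r : 'I_ _ => if odd r then 0 else F r)); last first.
  move=> r _; have rn := ltn_ord r.
  have or : odd ((a + b).*2.+1 - r) = ~~ odd r by lia.
  rewrite /window_lim or; case: ifP => /= or0.
    by rewrite big1 // => u _; rewrite andbF mulr0.
  have [M0|M0] := posnP M; first by rewrite /F M0 !big_geq.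
  rewrite (@big_cat_nat _ _ _ M.+1) //=; last by lia.
  rewrite [X in _ + X]big_nat_cond [X in _ + X]big1 ?addr0.
    by apply: eq_big_nat => u /andP[_ uM]; rewrite -ltnS uM.
  by move=> u /andP[/andP[Mu _] _]; rewrite leqNgt Mu /= mulr0.
rewrite sum_even_terms; apply: eq_bigr => r _; rewrite /F.
have -> : ((a + b).*2.+1 - r.*2 = (a + b - r).*2.+1)%N by have := ltn_ord r; lia.
rewrite -mulr_suml mulrC; congr (_ * _).
rewrite big_add1 /= big_mkord !mulr_sumr -big_split; apply: eq_bigr => v _ /=.
by rewrite [(-1) ^+ v.+1]exprS; ring.
Qed.

Lemma nested_altsum_dist_le a b M :
  `|nested_altsum R a b M - beta_zeta_sum a b M| <=
  2 * (\sum_(r < (a.*2 + b.*2).+1) ('C(r, a.*2)%:R + 'C(r, b.*2)%:R)) *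
  \sum_(1 <= u < M.*2) u%:R^-1 * h (M - u + (u - M))%N.
Proof.
rewrite beta_zeta_sumE nested_altsum_partial_fractions.
rewrite -sumrB [leRHS]mulr_sumr; apply: le_trans (ler_norm_sum _ _ _) _.
apply: ler_sum_nat => u /andP[u0 uM]; rewrite -sumrB.
apply: le_trans (ler_norm_sum _ _ _) _.
rewrite -mulrA mulr_suml mulr_sumr; apply: ler_sum => r _.
rewrite -mulrBr !normrM ger0_norm ?invr_ge0 ?exprn_ge0 //.
set c := 'C(r, _)%:R; set d := 'C(r, _)%:R.
have -> : 2 * ((c + d) * (u%:R^-1 * h (M - u + (u - M))%N)) =
   u%:R^-1 * (c + d) * (2 * h (M - u + (u - M))%N) by ring.
apply: ler_pM => //.
  apply: ler_pM => //.
    rewrite lef_pV2 ?posrE ?exprn_gt0 ?ltr0n ?double_gt0 //.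
    rewrite -natrX ler_nat (leq_trans _ (leq_pexp2l _ (ltn0Sn r))) ?double_gt0 //.
    by rewrite expn1 -addnn leq_addr.
  apply: le_trans (ler_normB _ _) _; rewrite normrM normr_sign mul1r.
  by rewrite !ger0_norm.
apply: window_dist_le; last exact: ltnW.
by have := ltn_ord r; lia.
Qed.

(** Stated for the difference because both terms diverge when a = 0; their distance is O(log M /
    M). *)
Lemma nested_altsum_cvg a b :
  (fun M => nested_altsum R a b M - beta_zeta_sum a b M) @ \oo --> 0.
Proof.
set K := \sum_(r < (a.*2 + b.*2).+1) ('C(r, a.*2)%:R + 'C(r, b.*2)%:R) : R.
have K0 : 0 <= K by apply: sumr_ge0 => r _; exact: addr_ge0.
apply: (@cvg_of_dist_le _ _ (fun M => 2 * K * 3 * (h M * \sum_(J < M.+1) h J))).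
  move=> M; rewrite sub0r normrN; apply: le_trans (nested_altsum_dist_le _ _ _) _.
  by rewrite -[leRHS]mulrA ler_wpM2l ?mulr_ge0 // harmonic_conv_le.
rewrite -[X in _ --> X](mulr0 (2 * K * 3)).
by apply: cvgM; [exact: cvg_cst|exact: harmonic_series_small].
Qed.

End DoubleSumLimit.

(** * Zeta values *)

Section ZetaValues.
Variable R : realType.
Local Notation h := (@harmonic R).

Definition zsum (s M : nat) : R := \sum_(v < M) (v.+1)%:R ^- s.

Definition etasum (s M : nat) : R := \sum_(v < M) (-1) ^+ v * (v.+1)%:R ^- s.

Lemma zsum_cvg s : (1 < s)%N -> zsum s @ \oo --> zeta (s%:R : R).
Proof.
move=> s1; have -> : zeta (s%:R : R) = limn (zsum s).
  rewrite /zeta; congr (limn _); apply/funext => M.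
  rewrite seriesEord /zsum; apply: eq_bigr => v _.
  by rewrite /riemannR powR_mulrn.
have e0 : (fun m => 2 * 1 * h m) @ \oo --> 0.
  by rewrite -[X in _ --> X](mulr0 (2 * 1)); apply: cvgM; [exact: cvg_cst|exact: cvg_harmonic].
have rate m k : `|zsum s (m + k) - zsum s m| <= 2 * 1 * h m.
  apply: (@square_tail_le _ (fun v => (v.+1)%:R ^- s)) => // J.
  rewrite mul1r ger0_norm ?invr_ge0 ?exprn_ge0 // -(subnKC s1) exprD invfM exprVn.
  by rewrite ler_piMr ?invr_ge0 ?exprn_ge0 // invf_le1 ?exprn_gt0 // exprn_ege1 // ler1n.
by have [] := cauchy_rate_cvg rate e0.
Qed.

Lemma etasum_cvg s : (0 < s)%N -> etasum s @ \oo --> limn (etasum s).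
Proof.
move=> s0; have rate m k : `|etasum s (m + k) - etasum s m| <= h m.
  apply: (@le_trans _ _ (m.+1%:R ^- s)).
    apply: (@alternating_tail_le _ (fun J => (J.+1)%:R ^- s)) => J.
      by rewrite invr_ge0 exprn_ge0.
    by rewrite lef_pV2 ?posrE ?exprn_gt0 // lerXn2r ?nnegrE // ler_nat.
  rewrite harmonicE lef_pV2 ?posrE ?exprn_gt0 // -[leLHS]expr1 ler_weXn2l //.
  by rewrite ler1n.
by have [] := cauchy_rate_cvg rate cvg_harmonic.
Qed.

Lemma cvg_double (u : R ^nat) (l : R) : u @ \oo --> l ->
  (fun M => u M.*2) @ \oo --> l.
Proof.
move=> ul; apply: (@cvg_comp _ _ _ double u _ _ _ _ ul).
by move=> P [N _ NP]; exists N => // n /= Nn; apply: NP; rewrite /= -addnn; lia.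
Qed.

Lemma etasum_double s M : etasum s M.*2 = zsum s M.*2 - 2 * 2 ^- s * zsum s M.
Proof.
elim: M => [|M IH]; first by rewrite /etasum /zsum !big_ord0 mulr0 subr0.
rewrite doubleS /etasum /zsum !big_ord_recr /= -/(etasum s _) -/(zsum s _) -/(zsum s _) IH.
rewrite [(-1) ^+ _.+1]exprS !signr_double -doubleS -[M.+1.*2]mul2n natrM exprMn invfM.
ring.
Qed.

Lemma etasum_lim s : (1 < s)%N -> etasum s @ \oo --> (1 - 2 * 2 ^- s) * zeta (s%:R : R).
Proof.
move=> s1; have ec := etasum_cvg (ltnW s1).
suff -> : (1 - 2 * 2 ^- s) * zeta s%:R = limn (etasum s) by [].
rewrite -(cvg_lim _ (cvg_double ec)) //; apply/esym/cvg_lim => //.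
under eq_fun do rewrite etasum_double.
rewrite mulrBl mul1r; apply: cvgB; first exact: (cvg_double (zsum_cvg s1)).
by apply: cvgM; [exact: cvg_cst|exact: zsum_cvg].
Qed.

(** Summing 1/(x+1) <= ln((x+1)/x) <= 1/x over a block makes the bounds telescope. *)
Lemma zsum1_ln K n : (0 < K)%N ->
  0 <= ln (K + n)%:R - ln K%:R - (zsum 1 (K + n) - zsum 1 K)
    <= K%:R^-1 - (K + n)%:R^-1.
Proof.
move=> K0; elim: n => [|n IH]; first by rewrite addn0; lra.
have p0 : 0 < (K + n)%:R :> R by rewrite ltr0n ltn_addr.
have p1 : 0 < (K + n.+1)%:R :> R by rewrite ltr0n ltn_addr.
have e : (K + n.+1)%:R = (K + n)%:R + 1 :> R by rewrite addnS natr1.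
have up : ln (K + n.+1)%:R - ln (K + n)%:R <= (K + n)%:R^-1 :> R.
  rewrite -ln_div ?posrE // e mulrDl divff ?lt0r_neq0 // mul1r.
  by rewrite le_ln1Dx // (lt_trans (ltrN10 _)) // invr_gt0.
have lo : (K + n.+1)%:R^-1 <= ln (K + n.+1)%:R - ln (K + n)%:R :> R.
  have -> : ln (K + n.+1)%:R - ln (K + n)%:R = - ln (1 - (K + n.+1)%:R^-1) :> R.
    rewrite -opprB -ln_div ?posrE // e; congr (- ln _).
    have := lt0r_neq0 p1; rewrite e; move: (K + n)%:R => x x0; field.
    exact: x0.
  rewrite lerNr le_ln1Dx // ltrN2 invf_lt1 // ltr1n; lia.
have -> : zsum 1 (K + n.+1) = zsum 1 (K + n) + (K + n.+1)%:R^-1.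
  by rewrite addnS /zsum big_ord_recr /= expr1.
lra.
Qed.

(** The partial sum of length 2M is H_(2M) - H_M, which [zsum1_ln] compares with ln(2M) - ln M. *)
Lemma etasum1_ln2 : etasum 1 @ \oo --> (ln 2 : R).
Proof.
have ec := etasum_cvg (ltn0Sn 0).
suff -> : ln 2 = limn (etasum 1) by [].
rewrite -(cvg_lim _ (cvg_double ec)) //; apply/esym/cvg_lim => //.
rewrite -cvg_shiftS; apply: (@cvg_of_dist_le _ _ h); last exact: cvg_harmonic.
move=> M /=; rewrite etasum_double expr1 divff ?pnatr_eq0 // mul1r.
have := @zsum1_ln M.+1 M.+1 (ltn0Sn M); rewrite addnn.
have -> : ln (M.+1.*2)%:R - ln M.+1%:R = ln 2 :> R.
  by rewrite -ln_div ?posrE ?ltr0n // -mul2n natrM mulfK ?pnatr_eq0.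
have : 0 <= (M.+1.*2)%:R^-1 :> R by rewrite invr_ge0.
by move=> p /andP[lo up]; rewrite ger0_norm // (le_trans up) // gerBl.
Qed.

Lemma even_zetaE r M : even_zeta R r M = 2 ^- r.*2.+1 * zsum r.*2.+1 M.
Proof.
rewrite /even_zeta /zsum mulr_sumr; apply: eq_bigr => v _.
by rewrite -mul2n natrM exprMn invfM.
Qed.

Lemma even_etaE r M : even_eta R r M = 2 ^- r.*2.+1 * etasum r.*2.+1 M.
Proof.
rewrite /even_eta /etasum mulr_sumr; apply: eq_bigr => v _.
by rewrite -mul2n natrM exprMn invfM mulrCA.
Qed.

Lemma even_zeta_cvg r :
  even_zeta R r.+1 @ \oo --> 2 ^- r.+1.*2.+1 * zeta (r.+1.*2.+1%:R : R).
Proof.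
have -> : even_zeta R r.+1 = (fun M => 2 ^- r.+1.*2.+1 * zsum r.+1.*2.+1 M).
  by apply/funext => M; exact: even_zetaE.
by apply: cvgM; [exact: cvg_cst|exact: zsum_cvg].
Qed.

Lemma even_eta_cvg r : even_eta R r.+1 @ \oo -->
  2 ^- r.+1.*2.+1 * ((1 - 2 * 2 ^- r.+1.*2.+1) * zeta (r.+1.*2.+1%:R : R)).
Proof.
have -> : even_eta R r.+1 = (fun M => 2 ^- r.+1.*2.+1 * etasum r.+1.*2.+1 M).
  by apply/funext => M; exact: even_etaE.
by apply: cvgM; [exact: cvg_cst|exact: etasum_lim].
Qed.

Lemma even_eta0_cvg : even_eta R 0 @ \oo --> (2^-1 * ln 2 : R).
Proof.
have -> : even_eta R 0 = (fun M => 2 ^- 1 * etasum 1 M).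
  by apply/funext => M; exact: even_etaE.
by rewrite expr1; apply: cvgM; [exact: cvg_cst|exact: etasum1_ln2].
Qed.

(** The sum over r of the theorem before the factor [pflim], which turns each beta value into a star
    value. *)
Definition beta_zeta_value (a b : nat) : R :=
  \sum_(1 <= r < (a + b).+1) dbeta R (a + b - r).*2.+1 *
    (2 ^- (2 * r) * ('C(2 * r, 2 * a)%:R + (1 - 2 ^- (2 * r)) * 'C(2 * r, 2 * b)%:R) *
     zeta (2 * r + 1)%:R).

(** Only r = 0 is special: its binomials are nonzero just for a = 0 or b = 0. The first gives the
    divergent harmonic sum, removed here; the second gives the log 2 term. *)
Lemma beta_zeta_sum_cvg a b :
  (fun M => beta_zeta_sum R a b M
     - (a == 0%N)%:R * (2 * dbeta R (a + b).*2.+1) * even_zeta R 0 M) @ \oo -->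
  beta_zeta_value a b + (b == 0%N)%:R * (ln 2 * dbeta R (a + b).*2.+1).
Proof.
have -> : (fun M => beta_zeta_sum R a b M
     - (a == 0%N)%:R * (2 * dbeta R (a + b).*2.+1) * even_zeta R 0 M) =
  (fun M => \sum_(r < a + b) 2 * dbeta R (a + b - r.+1).*2.+1 *
      ('C(r.+1.*2, a.*2)%:R * even_zeta R r.+1 M
       + 'C(r.+1.*2, b.*2)%:R * even_eta R r.+1 M)
    + 2 * dbeta R (a + b).*2.+1 * ((b == 0%N)%:R * even_eta R 0 M)).
  apply/funext => M; rewrite /beta_zeta_sum big_ord_recl /= subn0.
  rewrite double0 !bin0n !double_eq0; set S := \sum_(i < _) _.
  ring.
apply: cvgD.
  rewrite /beta_zeta_value big_add1 /= big_mkord; apply: cvg_sum_seq => r.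
  have s1 : (1 < r.+1.*2.+1)%N by [].
  have -> : dbeta R (a + b - r.+1).*2.+1 *
    (2 ^- (2 * r.+1) * ('C(2 * r.+1, 2 * a)%:R + (1 - 2 ^- (2 * r.+1)) * 'C(2 * r.+1, 2 * b)%:R) *
     zeta (2 * r.+1 + 1)%:R) =
    2 * dbeta R (a + b - r.+1).*2.+1 *
    ('C(r.+1.*2, a.*2)%:R * (2 ^- r.+1.*2.+1 * zeta r.+1.*2.+1%:R) +
     'C(r.+1.*2, b.*2)%:R *
       (2 ^- r.+1.*2.+1 * ((1 - 2 * 2 ^- r.+1.*2.+1) * zeta r.+1.*2.+1%:R))) :> R.
    rewrite !mul2n addn1; move: (r.+1.*2) => d; rewrite exprS invfM.
    have q0 : 2 ^+ d != 0 :> R by rewrite expf_neq0 // pnatr_eq0.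
    by field.
  apply: cvgM; first exact: cvg_cst.
  apply: cvgD; apply: cvgM; try exact: cvg_cst.
    exact: even_zeta_cvg.
  exact: even_eta_cvg.
have -> : (b == 0%N)%:R * (ln 2 * dbeta R (a + b).*2.+1) =
  2 * dbeta R (a + b).*2.+1 * ((b == 0%N)%:R * (2^-1 * ln 2)) :> R by field.
apply: cvgM; first exact: cvg_cst.
by apply: cvgM; [exact: cvg_cst|exact: even_eta0_cvg].
Qed.

End ZetaValues.

(** * Regularized values *)

Section RegularizedValues.
Variables (R : realType) (phi : ncpoly -> {poly R}).
Hypothesis hphi : stuffle_regularization phi.

(** The default head 0 excludes the empty index. *)
Definition admissible (l : seq nat) := (1 < head 0 l)%N && all (leq 1) l.

Lemma phi_sum_admissible (s : seq (seq nat)) : all admissible s ->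
  \sum_(l <- s) phi (zword l) = (\sum_(l <- s) mtv R l)%:P.
Proof.
move=> /allP adm; rewrite rmorph_sum big_seq [RHS]big_seq; apply: eq_bigr => l /adm.
by case: l => // k l /andP[k1 /andP[_ lp]]; exact: (reg_mtv hphi).
Qed.

Lemma tsum_sum_cvg (s : seq (seq nat)) : all admissible s ->
  (fun N => \sum_(l <- s) tsum R 0 N l) @ \oo --> \sum_(l <- s) mtv R l.
Proof.
elim: s => [_|l s IH /andP[adm /IH {}IH]].
  by rewrite big_nil; under eq_fun do rewrite big_nil; exact: cvg_cst.
rewrite big_cons; under eq_fun do rewrite big_cons.
apply: cvgD => //; case: l adm => // k l /andP[k1 /andP[_ lp]].
exact: tsum_cvg_admissible.
Qed.

Lemma merges_admissible ks : admissible ks -> all admissible (merges ks).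
Proof.
move=> /andP[k1 ksp]; apply/allP => l lm.
by rewrite /admissible (leq_trans k1 (head_merges lm)) (merges_gt0 ksp lm).
Qed.

Lemma stuffle1_admissible l : admissible l -> all admissible (behead (stuffle1 l)).
Proof.
case: l => // k l /andP[/= k1 /andP[k0 lp]].
rewrite /admissible /= lp ltnS (ltnW k1) /=; apply/allP => _ /mapP[l' l'm ->] /=.
by rewrite k1 k0 (stuffle1_gt0 lp l'm).
Qed.

(** Merging never lowers the first entry, so V does not appear. *)
Lemma phi_S_cvg ks (L : R) : admissible ks ->
  tsum R 1 ^~ ks @ \oo --> L -> phi (S_map (zword ks)) = L%:P.
Proof.
move=> adm tL; rewrite (phi_S hphi); last by case/andP: adm.
have madm := merges_admissible adm.
rewrite phi_sum_admissible //; congr (_%:P).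
rewrite -(cvg_lim _ tL) //; apply/esym/cvg_lim => //.
by under eq_fun do rewrite tsum_merges; exact: tsum_sum_cvg.
Qed.

(* Comparing the stuffle product by z_1 with the truncated one, in which the
   odd harmonic sum plays the role of the indeterminate. *)
Lemma phi_S1_cvg ks (L c : R) : (ks == [::]) || admissible ks ->
  tsum R 1 ^~ ks @ \oo --> L ->
  (fun N => tsum R 1 N (1%N :: ks) - tsum R 1 N [:: 1%N] * tsum R 1 N ks) @ \oo --> c ->
  phi (S_map (zword (1%N :: ks))) = 'X * L%:P + c%:P.
Proof.
move=> ksadm tL tc; have [ks0|ks0] := eqVneq ks [::].
  rewrite ks0 in tL tc *; rewrite (phi_S hphi) // big_seq1.
  have -> : L = 1 by rewrite -(cvg_lim _ tL) // lim_cst.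
  have -> : c = 0.
    rewrite -(cvg_lim _ tc) //; under eq_fun do rewrite mulr1 subrr.
    exact: lim_cst.
  by rewrite addr0 mulr1 /zword big_seq1 (reg_z1 hphi).
have {ksadm} adm : admissible ks by move: ksadm; rewrite (negbTE ks0).
have ksp : all (leq 1) ks by case/andP: adm.
have madm := merges_admissible adm.
(* [bumps] collects the merges in which the leading 1 is added to the next entry, [rests] the
   stuffle terms that do not start with 1; all are admissible. *)
pose bumps := [seq (head 0%N l).+1 :: behead l | l <- merges ks].
pose rests := flatten [seq behead (stuffle1 l) | l <- merges ks].
have badm : all admissible bumps.
  apply/allP => _ /mapP[l /(allP madm) + ->]; case: l => // k l /andP[/= k1 /andP[_ lp]].
  by rewrite /admissible /= lp ltnS (ltnW k1).
have radm : all admissible rests.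
  by apply/allP => l /flatten_mapP[l' /(allP madm) /stuffle1_admissible /allP]; exact.
have split_merges (V : zmodType) (f : seq nat -> V) :
    \sum_(l <- merges (1%N :: ks)) f l =
    \sum_(l <- merges ks) f (1%N :: l) + \sum_(l <- bumps) f l.
  by rewrite merges_cons // big_cat /bumps !big_map.
have split_stuffle (V : zmodType) (f : seq nat -> V) :
    \sum_(l <- merges ks) \sum_(l' <- stuffle1 l) f l' =
    \sum_(l <- merges ks) f (1%N :: l) + \sum_(l <- rests) f l.
  rewrite /rests big_flatten big_map -big_split; apply: eq_bigr => l _.
  by case: l => [|k l]; rewrite !(big_cons, big_nil).
(* The divergent terms [1 :: l] occur in both expansions and cancel before the limit is taken. *)
have -> : c = \sum_(l <- bumps) mtv R l - \sum_(l <- rests) mtv R l.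
  rewrite -(cvg_lim _ tc) //; apply/cvg_lim => //.
  have -> : (fun N => tsum R 1 N (1%N :: ks) - tsum R 1 N [:: 1%N] * tsum R 1 N ks) =
      (fun N => \sum_(l <- bumps) tsum R 0 N l - \sum_(l <- rests) tsum R 0 N l).
    apply/funext => N; rewrite !tsum_merges split_merges big_seq1 mulr_sumr.
    rewrite (eq_bigr _ (fun l _ => tsum_stuffle1 R N l)) split_stuffle.
    ring.
  by apply: cvgB; exact: tsum_sum_cvg.
rewrite -(phi_S_cvg adm tL) !(phi_S hphi) //= mulr_sumr split_merges.
have -> : \sum_(l <- merges ks) 'X * phi (zword l) =
    \sum_(l <- merges ks) \sum_(l' <- stuffle1 l) phi (zword l').
  rewrite big_seq [RHS]big_seq; apply: eq_bigr => l /(allP madm) /andP[_ lp].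
  exact: (phi_z1M hphi).
rewrite split_stuffle rmorphB /= -!phi_sum_admissible //.
rewrite -[RHS]addrA; congr (_ + _); by rewrite addrC subrK.
Qed.

End RegularizedValues.

(** * Values of the limits and cancellation of the divergent parts *)

Section StarValues.
Variable R : realType.

Lemma mtv_star_nseq2 b : mtv_star R (nseq b 2%N) = pflim R * dbeta R b.*2.+1.
Proof. exact: mtv_star_cvg (@tsum_star_nseq2_cvg R b). Qed.

Lemma pflim_beta_zeta_value a b : pflim R * beta_zeta_value R a b =
  \sum_(1 <= r < (a + b).+1)
       2 ^- (2 * r) *
       ('C(2 * r, 2 * a)%:R + (1 - 2 ^- (2 * r)) * 'C(2 * r, 2 * b)%:R) *
       mtv_star R (nseq (a + b - r) 2%N) * zeta (2 * r + 1)%:R.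
Proof.
rewrite /beta_zeta_value mulr_sumr; apply: eq_bigr => r _.
by rewrite mtv_star_nseq2; ring.
Qed.

Lemma nested_altsum_cvg_pos a b : nested_altsum R a.+1 b @ \oo -->
  beta_zeta_value R a.+1 b + (b == 0%N)%:R * (ln 2 * dbeta R (a.+1 + b).*2.+1).
Proof.
have -> : nested_altsum R a.+1 b = (fun M =>
    (nested_altsum R a.+1 b M - beta_zeta_sum R a.+1 b M) + beta_zeta_sum R a.+1 b M).
  by apply/funext => M; rewrite subrK.
rewrite -[X in _ --> X]add0r; apply: cvgD; first exact: nested_altsum_cvg.
have := @beta_zeta_sum_cvg R a.+1 b; rewrite /=.
by under eq_fun do rewrite !mul0r subr0.
Qed.

(** The divergent parts cancel because L beta(2b+1) beta(1) = beta(2b+1). The subtracted case b = 0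
    has an empty sum over r and contributes only log 2, the source of V - log 2. *)
Lemma nested_altsum_cvg_zero b :
  (fun M => nested_altsum R 0 b M
     - pflim R * dbeta R b.*2.+1 * nested_altsum R 0 0 M) @ \oo -->
  beta_zeta_value R 0 b + (b == 0%N)%:R * (ln 2 * dbeta R b.*2.+1)
  - dbeta R b.*2.+1 * ln 2.
Proof.
set B := pflim R * _.
have e : B * dbeta R 1 = dbeta R b.*2.+1 by rewrite /B mulrAC pflim_dbeta1 mul1r.
have -> : (fun M => nested_altsum R 0 b M - B * nested_altsum R 0 0 M) =
  (fun M => (nested_altsum R 0 b M - beta_zeta_sum R 0 b M)
    + (beta_zeta_sum R 0 b M - 1 * (2 * dbeta R (0 + b).*2.+1) * even_zeta R 0 M)
    - B * ((nested_altsum R 0 0 M - beta_zeta_sum R 0 0 M)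
    + (beta_zeta_sum R 0 0 M - 1 * (2 * dbeta R (0 + 0).*2.+1) * even_zeta R 0 M))).
  by apply/funext => M; rewrite !add0n double0 -e; ring.
have -> : beta_zeta_value R 0 b + (b == 0%N)%:R * (ln 2 * dbeta R b.*2.+1)
    - dbeta R b.*2.+1 * ln 2 =
  0 + (beta_zeta_value R 0 b + (b == 0%N)%:R * (ln 2 * dbeta R (0 + b).*2.+1))
  - B * (0 + (beta_zeta_value R 0 0 + 1 * (ln 2 * dbeta R (0 + 0).*2.+1))).
  have -> : beta_zeta_value R 0 0 = 0 by rewrite /beta_zeta_value big_geq.
  by rewrite !add0n double0 -e; ring.
apply: cvgB; last first.
  apply: cvgM; first exact: cvg_cst.
  by apply: cvgD; [exact: nested_altsum_cvg|exact: beta_zeta_sum_cvg].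
by apply: cvgD; [exact: nested_altsum_cvg|exact: beta_zeta_sum_cvg].
Qed.

End StarValues.

Theorem theorem4p2 (R : realType) (phi : ncpoly -> {poly R})
    (hphi : stuffle_regularization phi) (a b : nat) :
  mtv_star_reg phi (nseq a 2 ++ 1 :: nseq b 2)%N =
    (\sum_(1 <= r < (a + b).+1)
       2 ^- (2 * r) *
       ('C(2 * r, 2 * a)%:R + (1 - 2 ^- (2 * r)) * 'C(2 * r, 2 * b)%:R) *
       mtv_star R (nseq (a + b - r) 2%N) * zeta (2 * r + 1)%:R)%:P
    + (a == 0%N)%:R * ('X - (ln 2)%:P) * (mtv_star R (nseq b 2%N))%:P
    + (b == 0%N)%:R * (ln 2 * mtv_star R (nseq a 2%N))%:P.
Proof.
rewrite -pflim_beta_zeta_value /mtv_star_reg.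
have pos n : all (leq 1) (nseq n 2%N) by rewrite all_nseq orbT.
case: a => [|a].
  rewrite cat0s (phi_S1_cvg hphi _ (@tsum_star_nseq2_cvg R b)
    (tsum_star_1_nseq2_cvg (@nested_altsum_cvg_zero R b))); last first.
    by case: b => // b; rewrite /admissible /= pos.
  have e0 : mtv_star R (nseq 0 2%N) = 1 by rewrite mtv_star_nseq2 pflim_dbeta1.
  rewrite e0 mtv_star_nseq2 eqxx mul1r mulr1.
  set B := pflim R * dbeta R _.
  have -> : pflim R * (beta_zeta_value R 0 b + (b == 0%N)%:R * (ln 2 * dbeta R b.*2.+1)
      - dbeta R b.*2.+1 * ln 2) =
      pflim R * beta_zeta_value R 0 b + (b == 0%N)%:R * ln 2 - ln 2 * B.
    (* For b = 0 the factor L beta(1) in front of log 2 is 1. *)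
    rewrite /B; case: b {B} => [|b].
      by rewrite double0 pflim_dbeta1 eqxx !mul1r mulr1; ring.
    by rewrite !mul0r; ring.
  by rewrite rmorphB rmorphD !rmorphM /= rmorph_nat; ring.
(* A leading 2 makes the index admissible, so the value is constant in V. *)
rewrite (phi_S_cvg hphi _ (tsum_star_nseq2_1_nseq2_cvg (@nested_altsum_cvg_pos R a b))).
  rewrite !mul0r addr0 mtv_star_nseq2.
  have -> : pflim R * (beta_zeta_value R a.+1 b
        + (b == 0%N)%:R * (ln 2 * dbeta R (a.+1 + b).*2.+1)) =
      pflim R * beta_zeta_value R a.+1 b
        + (b == 0%N)%:R * (ln 2 * (pflim R * dbeta R a.+1.*2.+1)).
    by case: b => [|b]; rewrite ?addn0 ?mul0r; ring.
  by rewrite rmorphD; congr (_ + _); rewrite rmorphM /= rmorph_nat.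
by rewrite /admissible /= all_cat /= !pos.
Qed.
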